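(* Let $X\subseteq\mathbb{P}^r$ be a quasi-projective variety of dimension $n\ge 1$ and let $k\geq 1$. If $\mathfrak{t}_k=\theta_k+\delta_k$, then the $(k+2)$-th fundamental form vanishes at a generic point of $X$, i.e. $\mathbf{F}_{k+2,x}=0$ for a generic point $x\in X$.
   Context: Work over $\mathbb{C}$; a variety is separated, reduced, irreducible, of finite type over $\mathbb{C}$. Let $L=\mathcal{O}_X(1)$, $V=H^0(\mathbb{P}^r,\mathcal{O}_{\mathbb{P}^r}(1))$, so $\mathbb{P}^r=\mathbb{P}(V)$ is the space of one-dimensional quotients of $V$, i.e. of lines in $V^*$. ${}^*$ denotes the dual. For $k\ge 0$ let $P^k(L)=pr_{1,*}\big((\mathcal{O}_{X\times X}/I_\Delta^{k+1})\otimes pr_2^*L\big)$ be the sheaf of $k$-th order principal parts, with universal differential operator $d^k_L:L\to P^k(L)$ induced by $pr_2$. The Taylor series map is the $\mathcal{O}_X$-linear map $\alpha_k:V\otimes\mathcal{O}_X\to P^k(L)$, $T\otimes a\mapsto a\,d^k_L(T|_X)$. Put $R_k=(\ker\alpha_k)\otimes L^*$, $P_k=(\operatorname{Im}\alpha_k)\otimes L^*$, and define $\mathfrak{t}_k$ by $\mathfrak{t}_k+1=\operatorname{rank}P_k$. Let $\mathbf{U}_k$ be the maximal open subset of $X$ contained in the nonsingular locus on which $P^i(L)/(P_i\otimes L)$ is locally free of constant rank for all $i\le k$. Fundamental forms: over the nonsingular locus, the kernel of the truncation $P^k(L)\to P^{k-1}(L)$ is $S^k\Omega^1_X\otimes L$,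 and $\alpha_k$ restricted to $R_{k-1}\otimes L=\ker\alpha_{k-1}$ lands in it; twisting by $L^*$ gives $\mathbf{F}^*_k:R_{k-1}\to S^k\Omega^1_X$. Its dual is $\mathbf{F}_k$; tensored with the residue field $k(x)$ at a generic point $x$ (where $R_{k-1}$ is locally free) it gives $\mathbf{F}_{k,x}:S^kT_x(X)\to R_{k-1}^*\otimes k(x)$. $k$-th projective tangent space: $\mathbf{T}^k_x(X)=\mathbb{P}(P_k\otimes L\otimes k(x))\subseteq\mathbb{P}^r$ with corresponding linear subspace $\widehat{\mathbf{T}}^k_x(X)\subseteq V^*$; for $x\in\mathbf{U}_k$ it has projective dimension $\mathfrak{t}_k$. The map $f_{k+1,x}$: on $\mathbf{U}_k$, $P_k^*\otimes L^*$ is a subbundle of $V^*\otimes\mathcal{O}_X$ with fibre $\widehat{\mathbf{T}}^k_x(X)$ at $x$. A local vector field $\partial$ acts on $V^*\otimes\mathcal{O}_X$ by $\mathrm{id}\otimes\partial$. For $x\in\mathbf{U}_k$, $u\in T_x(X)$, $v\in\widehat{\mathbf{T}}^k_x(X)$, choose a local vector field $\partial_u$ with $\partial_u(x)=u$ and a local section $B_v$ of $P_k^*\otimes L^*$ with $B_v(x)=v$; then $f_{k+1,x}(u,v)=\partial_u(B_v)(x)\bmod\widehat{\mathbf{T}}^k_x(X)$, which is independent of the choices and defines a bilinear map $f_{k+1,x}:T_x(X)\times\widehat{\mathbf{T}}^k_x(X)\to V^*/\widehat{\mathbf{T}}^k_x(X)$. For $u\in T_x(X)$ write $f_{k+1,x}(u)=f_{k+1,x}(u,\cdot)$.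 Numerical invariants: $\theta_k=\operatorname{rank}f_{k+1,x}(u)$ for generic $x\in X$ and generic $u\in T_x(X)$; $\delta_k=\dim\big(\mathbf{T}^k_x(X)\cap\mathbf{T}^k_y(X)\big)$ for generic $x,y\in X$, with $\delta_k=-1$ if the intersection is empty. *)

(* Defs.v *)
From mathcomp Require Import all_boot all_order all_algebra all_fingroup.
From mathcomp Require Export reals complex mpoly.

Set Implicit Arguments.
Unset Strict Implicit.
Unset Printing Implicit Defensive.

Import GRing.Theory.
Local Open Scope ring_scope.

(* Classical projective geometry over an algebraically closed field F, later   *)
(* the field R[i] of complex numbers.                                          *)
(*                                                                             *)
(* P^r = P(V) is the space of lines in V^*; V^* is 'rV[F]_r.+1, V is           *)
(* 'cV[F]_r.+1, and the linear form s takes the value (y *m s) 0 0 at y.  A    *)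
(* point of P^r is given by any of its nonzero representatives, so subsets of  *)
(* P^r are cones minus the origin, and a section of O(a) over an open set is a *)
(* function on the cone over it that is locally a quotient of homogeneous      *)
(* polynomials whose degrees differ by a (hence homogeneous of degree a;       *)
(* invariant under rescaling for a = 0).  Such functions are total, and only   *)
(* their values on the open set in question matter.  A stalk is dealt with     *)
(* through sections over neighbourhoods of the point.                          *)

Section ProjectiveVarieties.

Variables (F : closedFieldType) (r : nat).

Notation pt := 'rV[F]_r.+1.
Notation poly := {mpoly F[r.+1]}.

Implicit Types (X U Z A : pt -> Prop) (x y : pt) (a b : int).

Definition evp (p : poly) x : F := p.@[fun i => x 0 i].

Definition zclosed Z : Prop :=
  exists S : poly -> Prop,
    (forall p, S p -> exists d, p \is d.-homog) /\
    (forall x, Z x <-> x != 0 /\ forall p, S p -> evp p x = 0).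

Definition irreducible A : Prop :=
  (exists x, A x) /\
  forall Z1 Z2, zclosed Z1 -> zclosed Z2 ->
    (forall x, A x -> Z1 x \/ Z2 x) ->
    (forall x, A x -> Z1 x) \/ (forall x, A x -> Z2 x).

Definition quasi_projective_variety X : Prop :=
  irreducible X /\
  exists Z1 Z2, [/\ zclosed Z1, zclosed Z2 & forall x, X x <-> Z1 x /\ ~ Z2 x].

Definition open_in X U : Prop :=
  exists2 Z, zclosed Z & forall x, U x <-> X x /\ ~ Z x.

Definition closed_in X A : Prop :=
  exists2 Z, zclosed Z & forall x, A x <-> X x /\ Z x.

Definition open_nbhd X x U : Prop := open_in X U /\ U x.

Definition generically X (P : pt -> Prop) : Prop :=
  exists U, [/\ open_in X U, exists x, U x & forall x, U x -> P x].

(* There are irreducible closed subsets Z_0 < ... < Z_n of X. *)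
Definition has_chain X (n : nat) : Prop :=
  exists Z : 'I_n.+1 -> pt -> Prop,
    (forall i, irreducible (Z i) /\ closed_in X (Z i)) /\
    (forall i j : 'I_n.+1, (i < j)%N ->
       (forall x, Z i x -> Z j x) /\ exists2 x, Z j x & ~ Z i x).

Definition has_dim X (n : nat) : Prop := has_chain X n /\ ~ has_chain X n.+1.

(* A bihomogeneous polynomial in (x, y) is written as a sum of products        *)
(* p(x) q(y) of homogeneous polynomials.                                       *)
Definition bipoly := seq (poly * poly).

Definition bihomog (d e : nat) (p : bipoly) : Prop :=
  forall pq, pq \in p -> pq.1 \is d.-homog /\ pq.2 \is e.-homog.

Definition evb (p : bipoly) x y : F := \sum_(pq <- p) evp pq.1 x * evp pq.2 y.

Definition open_in2 X (W : pt -> pt -> Prop) : Prop :=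
  exists S : bipoly -> Prop,
    (forall p, S p -> exists d e, bihomog d e p) /\
    (forall x y, W x y <-> [/\ X x, X y & exists2 p, S p & evb p x y <> 0]).

Definition generically2 X (P : pt -> pt -> Prop) : Prop :=
  exists W, [/\ open_in2 X W, exists x y, W x y & forall x y, W x y -> P x y].

Definition secO a U (f : pt -> F) : Prop :=
  forall x, U x -> exists d e (p q : poly),
    [/\ p \is d.-homog, q \is e.-homog, d%:Z = e%:Z + a, evp q x <> 0
      & forall y, U y -> evp q y <> 0 -> f y = evp p y / evp q y].

(* Sections of pr_1^* O(a) (x) pr_2^* O(b). *)
Definition secO2 a b (W : pt -> pt -> Prop) (sigma : pt -> pt -> F) : Prop :=
  forall x y, W x y -> exists d1 d2 e1 e2 (p q : bipoly),
    [/\ bihomog d1 d2 p, bihomog e1 e2 q,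
        d1%:Z = e1%:Z + a /\ d2%:Z = e2%:Z + b, evb q x y <> 0
      & forall x' y', W x' y' -> evb q x' y' <> 0 ->
          sigma x' y' = evb p x' y' / evb q x' y'].

(* Sections of V (x) O(a) and of V^* (x) O. *)
Definition secV a U (s : pt -> 'cV[F]_r.+1) : Prop :=
  forall i, secO a U (fun x => s x i 0).

Definition secVdual U (B : pt -> 'rV[F]_r.+1) : Prop :=
  forall i, secO 0 U (fun x => B x 0 i).

(* The ideal of the diagonal: X is reduced, hence so is its diagonal. *)
Definition idealDelta (W : pt -> pt -> Prop) (g : pt -> pt -> F) : Prop :=
  secO2 0 0 W g /\ forall x, W x x -> g x x = 0.

(* An expression of sigma, over W, as an element of I_Delta^m (x) O(a,b). *)
Definition Ipow_expr (m : nat) a b (W : pt -> pt -> Prop) (N : nat)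
    (g : 'I_N -> 'I_m -> pt -> pt -> F) (tau : 'I_N -> pt -> pt -> F)
    (sigma : pt -> pt -> F) : Prop :=
  [/\ forall j i, idealDelta W (g j i), forall j, secO2 a b W (tau j)
    & forall x y, W x y ->
        sigma x y = \sum_(j < N) (\prod_(i < m) g j i x y) * tau j x y].

(* The germ of sigma at (x, x) lies in I_Delta^m (x) O(a,b).  The sheaf        *)
(* (O / I_Delta^(k+1)) (x) pr_2^* L is supported on the diagonal, so the stalk *)
(* at x of P^k(L) is the space of germs at (x, x) of sections of               *)
(* pr_2^* L = O(0,1), modulo Ipow X k.+1 0 1 x; similarly for P^k(L) (x) L^a   *)
(* with O(a,1).                                                                *)
Definition Ipow X (m : nat) a b x (sigma : pt -> pt -> F) : Prop :=
  exists W, [/\ open_in2 X W, W x x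
    & exists N (g : 'I_N -> 'I_m -> pt -> pt -> F) tau,
        Ipow_expr a b W g tau sigma].

(* The Taylor series map alpha_k sends s to the class of this section: for     *)
(* s = T (x) f it is f(x) T(y), that is, f d^k(T).                             *)
Definition taylor (s : pt -> 'cV[F]_r.+1) : pt -> pt -> F :=
  fun x y => (y *m s x) 0 0.

(* Sections over U of (ker alpha_k) (x) L^a. *)
Definition ker_taylor X (k : nat) a U (s : pt -> 'cV[F]_r.+1) : Prop :=
  secV a U s /\ forall x, U x -> Ipow X k.+1 a 1 x (taylor s).

Definition secR X (k : nat) U s : Prop := ker_taylor X k (-1) U s.

(* Sections over U of P_k^* (x) L^*, the dual of Im alpha_k, i.e. of           *)
(* V (x) O / ker alpha_k.                                                      *)
Definition secPdual X (k : nat) U (B : pt -> 'rV[F]_r.+1) : Prop :=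
  secVdual U B /\
  forall U' s, open_in X U' -> (forall x, U' x -> U x) ->
    ker_taylor X k 0 U' s -> forall x, U' x -> (B x *m s x) 0 0 = 0.

(* rank P_k: the dimension over the function field of X of the generic stalk   *)
(* (V (x) L^* )_eta / (R_k)_eta, via a basis.                                  *)
Definition rankP X (k m : nat) : Prop :=
  exists U (s : 'I_m -> pt -> 'cV[F]_r.+1),
    [/\ open_in X U, exists x, U x, forall i, secV (-1) U (s i),
        forall U' (f : 'I_m -> pt -> F),
          open_in X U' -> (exists x, U' x) -> (forall x, U' x -> U x) ->
          (forall i, secO 0 U' (f i)) ->
          secR X k U' (fun x => \sum_i f i x *: s i x) ->
          forall i x, U' x -> f i x = 0
      & forall U' t, open_in X U' -> (exists x, U' x) -> secV (-1) U' t ->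
          exists U'' (f : 'I_m -> pt -> F),
            [/\ open_in X U'', exists x, U'' x,
                forall x, U'' x -> U x /\ U' x,
                forall i, secO 0 U'' (f i)
              & secR X k U'' (fun x => t x - \sum_i f i x *: s i x)]].

Definition is_t X (k : nat) (t : int) : Prop :=
  exists2 m, rankP X k m & t + 1 = m%:Z.

(* A tangent vector at x is a derivation O_{X,x} -> k(x). *)
Definition tangent X x (u : (pt -> F) -> F) : Prop :=
  forall U, open_nbhd X x U -> forall f g, secO 0 U f -> secO 0 U g ->
    [/\ (forall y, U y -> f y = g y) -> u f = u g,
        forall c, u (fun y => c * f y + g y) = c * u f + u g
      & u (fun y => f y * g y) = f x * u g + g x * u f].

Definition lincomb (m : nat) (e : 'I_m -> (pt -> F) -> F) (c : 'I_m -> F) :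
    (pt -> F) -> F :=
  fun f => \sum_i c i * e i f.

Definition tangent_basis X x (m : nat) (e : 'I_m -> (pt -> F) -> F) : Prop :=
  [/\ forall i, tangent X x (e i),
      forall u, tangent X x u -> exists c, forall U f,
        open_nbhd X x U -> secO 0 U f -> u f = lincomb e c f
    & forall c, (forall U f, open_nbhd X x U -> secO 0 U f ->
                   lincomb e c f = 0) -> forall i, c i = 0].

Definition nonsingular X x : Prop :=
  X x /\ exists n, has_dim X n /\ exists e : 'I_n -> _, tangent_basis X x e.

(* P holds on a nonempty Zariski open subset of the vector space T_x(X). *)
Definition generically_tangent X x (P : ((pt -> F) -> F) -> Prop) : Prop :=
  exists m (e : 'I_m -> _) (p : {mpoly F[m]}),
    [/\ tangent_basis X x e, p != 0
      & forall c : 'I_m -> F, p.@[c] <> 0 -> P (lincomb e c)].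

(* Derivations of the sheaf O_U. *)
Definition vector_field X U (D : (pt -> F) -> pt -> F) : Prop :=
  forall U', open_in X U' -> (forall y, U' y -> U y) ->
  forall f g, secO 0 U' f -> secO 0 U' g ->
    [/\ secO 0 U' (D f),
        (forall y, U' y -> f y = g y) -> forall y, U' y -> D f y = D g y,
        forall c y, U' y -> D (fun z => c * f z + g z) y = c * D f y + D g y
      & forall y, U' y -> D (fun z => f z * g z) y = f y * D g y + g y * D f y].

Definition has_value X x (D : (pt -> F) -> pt -> F) (u : (pt -> F) -> F) :=
  forall U f, open_nbhd X x U -> secO 0 U f -> D f x = u f.

(* The stalk at x of P^i(L) / (P_i (x) L) = coker alpha_i is free of rank m. *)
Definition coker_taylor_free X (i : nat) x (m : nat) : Prop :=
  exists (W0 : pt -> pt -> Prop) (e : 'I_m -> pt -> pt -> F),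
    [/\ open_in2 X W0 /\ W0 x x, forall j, secO2 0 1 W0 (e j),
        forall W sigma, open_in2 X W -> W x x -> secO2 0 1 W sigma ->
          exists U (f : 'I_m -> pt -> F) s,
            [/\ open_nbhd X x U, forall j, secO 0 U (f j), secV 0 U s
              & Ipow X i.+1 0 1 x (fun y z =>
                  sigma y z - \sum_j f j y * e j y z - taylor s y z)]
      & forall U (f : 'I_m -> pt -> F) s,
          open_nbhd X x U -> (forall j, secO 0 U (f j)) -> secV 0 U s ->
          Ipow X i.+1 0 1 x (fun y z =>
            \sum_j f j y * e j y z - taylor s y z) ->
          exists2 U', open_nbhd X x U' & forall j y, U' y -> f j y = 0].

(* Coherent sheaves are locally free where their stalks are free. *)
Definition Uset X (k : nat) x : Prop :=
  exists U, [/\ open_nbhd X x U, forall y, U y -> nonsingular X y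
    & forall i, (i <= k)%N ->
        exists m, forall y, U y -> coker_taylor_free X i y m].

Definition subspace_dim (A : 'rV[F]_r.+1 -> Prop) (d : nat) : Prop :=
  exists M : 'M[F]_(d, r.+1),
    row_free M /\ forall v, A v <-> (v <= M)%MS.

(* The subspace of V^* attached to the k-th projective tangent space: the      *)
(* annihilator of the kernel of the quotient map V -> P_k (x) L (x) k(x),      *)
(* which is the image of ker alpha_k in V.                                     *)
Definition hatT X (k : nat) x (v : 'rV[F]_r.+1) : Prop :=
  forall U s, open_nbhd X x U -> ker_taylor X k 0 U s -> (v *m s x) 0 0 = 0.

Definition is_delta X (k : nat) (delta : int) : Prop :=
  generically2 X (fun x y => exists2 m,
    subspace_dim (fun v => hatT X k x v /\ hatT X k y v) m
    & delta = m%:Z - 1).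

(* w in V^* represents f_{k+1,x}(u, v) in V^* / hatT. *)
Definition fmap X (k : nat) x (u : (pt -> F) -> F) (v w : 'rV[F]_r.+1) : Prop :=
  exists U D B,
    [/\ open_nbhd X x U,
        vector_field X U D /\ has_value X x D u,
        secPdual X k U B, B x = v
      & hatT X k x (w - \row_i D (fun y => B y 0 i) x)].

(* The set of w below is the preimage in V^* of the image of f_{k+1,x}(u). *)
Definition fmap_rank X (k : nat) x (u : (pt -> F) -> F) (m : nat) : Prop :=
  exists2 d, subspace_dim (hatT X k x) d
  & subspace_dim (fun w => exists2 v, hatT X k x v & fmap X k x u v w) (d + m).

Definition is_theta X (k theta : nat) : Prop :=
  generically X (fun x => Uset X k x /\
    generically_tangent X x (fun u => fmap_rank X k x u theta)).

(* An element of S^k Omega^1 (x) k(x), written as a sum of tau_j times the     *)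
(* product over i of the classes of g_ji in I_Delta / I_Delta^2 = Omega^1,     *)
(* paired with the element u_1 ... u_k of S^k T_x(X).  The class of g in       *)
(* Omega^1 (x) k(x) = m_x / m_x^2 is that of y |-> g x y.                      *)
Definition sym_pairing (k N : nat) x (u : 'I_k -> (pt -> F) -> F)
    (g : 'I_N -> 'I_k -> pt -> pt -> F) (tau : 'I_N -> pt -> pt -> F) : F :=
  \sum_(j < N) tau j x x *
    \sum_(sigma : 'S_k) \prod_(i < k) u i (fun y => g j (sigma i) x y).

(* For k >= 1, c is the value of F_{k,x}(u_1 ... u_k) at the class of s in     *)
(* R_{k-1} (x) k(x): the Taylor section of s lies in I_Delta^k (x) O(-1,1),    *)
(* and F_k^*(s) is its class in S^k Omega^1 = I_Delta^k / I_Delta^(k+1).       *)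
Definition fund_form X (k : nat) x (u : 'I_k -> (pt -> F) -> F)
    (s : pt -> 'cV[F]_r.+1) (c : F) : Prop :=
  (exists2 U, open_nbhd X x U & secR X k.-1 U s) /\
  exists W N (g : 'I_N -> 'I_k -> pt -> pt -> F) tau,
    [/\ open_in2 X W, W x x, Ipow_expr (-1) 1 W g tau (taylor s)
      & c = sym_pairing x u g tau].

(* The products u_1 ... u_k span S^k T_x(X). *)
Definition fund_form_zero X (k : nat) x : Prop :=
  forall (u : 'I_k -> (pt -> F) -> F) s c,
    (forall i, tangent X x (u i)) -> fund_form X x u s c -> c = 0.

End ProjectiveVarieties.

(* Main.v *)
(* Along the flow of a vector field D near a generic point x, write T(t) for    *)
(* the affine k-th osculating space at the point of time t.  As                 *)
(* t_k = theta_k + delta_k, the generic dimension of T(0) + T(t) equals that of *)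
(* E = T(0) + D T(0), so a vector that is a limit of combinations of T(0) and   *)
(* T(t) lies in E.  Since k >= 1, both the (k-1)-st derivative b(t) of the      *)
(* curve and b'(t) lie in T(t), and the trapezoid rule                          *)
(*   b(t) - b(0) - t (b'(t) + b'(0)) / 2 = - t^3 b'''(0) / 12 + ...             *)
(* puts the (k+2)-nd derivative b'''(0) in E.  Now E is contained in the        *)
(* (k+1)-st osculating space, because D maps I_Delta^(k+2) to I_Delta^(k+1), so *)
(* the value of the (k+2)-nd fundamental form on D(x)^(k+2) is zero.  As D(x)   *)
(* may be any generic tangent vector, polarization concludes.  The flow is      *)
(* formal: exp(t D) is a ring homomorphism into power series, and its jets are  *)
(* polynomials modulo t^N.                                                      *)
Require Import Defs.
From mathcomp Require Import all_boot all_order all_algebra all_fingroup.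
From mathcomp Require Import boolp zify ring.

Set Implicit Arguments.
Unset Strict Implicit.
Unset Printing Implicit Defensive.

Import Order.TTheory GRing.Theory.
Local Open Scope ring_scope.

(** * Regular functions on quasi-projective cones *)

(** Near a generic point the affine osculating spaces T(y) of order k are the row spaces of a
    regular matrix B(y) with m = t_k + 1 independent rows ([generic_frame]). Two generic ones meet
    in dimension delta_k + 1, so their sum has dimension 2m - delta_k - 1, which the hypothesis
    turns into m + theta_k. If a vector field D has a generic value u at x, then E = T(x) + D T(x)
    has dimension at least m + theta_k, because it contains the preimage in V^* of the image of
    f_{k+1,x}(u) ([fmap_rank_vector_field]). So E leaves no room for further limits of vectors of
    T(x) + T(y) as y tends to x along the flow of D.

    Derivatives of order at most k of the normalized coordinates stay in T ([hatT_flow]). The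
    trapezoid rule combines those of orders k-1 and k into a vector of T(x) + T(y) whose leading
    term is a nonzero multiple of the derivative of order k+2, which therefore lies in E
    ([trapezoid_rule]). The limit is taken algebraically: minors of size dim E + 1 vanish
    identically, and so do their jets ([det_flow_eq0]).

    Sections of R_{k+1} annihilate E ([ker_taylor_frame]), while their pairing with the derivative
    of order k+2 is, up to a nonzero factor, the value of F_{k+2} at u^(k+2) ([iter_vf_taylor]).
    [fund_form_diag] puts the two together, and [polarization] passes from powers of generic tangent
    vectors to all products. *)

Section Sections.

Variables (F : closedFieldType) (r : nat).

Notation pt := 'rV[F]_r.+1.
Notation poly := {mpoly F[r.+1]}.

Implicit Types (X U : pt -> Prop) (W : pt -> pt -> Prop) (x y : pt).
Implicit Types (a b : int) (f g : pt -> F) (p q : poly).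

Lemma evpD p q x : evp (p + q) x = evp p x + evp q x.
Proof. exact: mevalD. Qed.

Lemma evpM p q x : evp (p * q) x = evp p x * evp q x.
Proof. exact: mevalM. Qed.

Lemma evpZ c p x : evp (c *: p) x = c * evp p x.
Proof. exact: mevalZ. Qed.

Lemma evp0 x : evp (0 : poly) x = 0.
Proof. exact: meval0. Qed.

Lemma evp1 x : evp (1 : poly) x = 1.
Proof. exact: meval1. Qed.

Lemma evpX i x : evp ('X_i : poly) x = x 0 i.
Proof. exact: mevalXU. Qed.

Lemma evp_exp p n x : evp (p ^+ n) x = evp p x ^+ n.
Proof. by rewrite /evp rmorphXn. Qed.

Lemma evp_sum (I : Type) (s : seq I) (G : I -> poly) x :
  evp (\sum_(i <- s) G i) x = \sum_(i <- s) evp (G i) x.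
Proof. exact: raddf_sum. Qed.

Lemma dhomog_coord i : ('X_i : poly) \is 1.-homog.
Proof. by rewrite dhomogX; apply/eqP; exact: mdeg1. Qed.

Lemma dhomog_coordX i n : ('X_i ^+ n : poly) \is n.-homog.
Proof. by rewrite -[X in X.-homog]mul1n dhomogMn // dhomog_coord. Qed.

Lemma secO_sub a U U' f :
  (forall x, U' x -> U x) -> secO a U f -> secO a U' f.
Proof.
move=> sU hf x U'x; have [d [e [p [q [hp hq hd hqx E]]]]] := hf x (sU _ U'x).
by exists d, e, p, q; split=> // y /sU; apply: E.
Qed.

Lemma secO_ext a U f g :
  (forall x, U x -> f x = g x) -> secO a U f -> secO a U g.
Proof.
move=> fg hf x Ux; have [d [e [p [q [hp hq hd hqx E]]]]] := hf x Ux.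
by exists d, e, p, q; split=> // y Uy hy; rewrite -fg //; apply: E.
Qed.

Lemma secO_frac a U d e p q :
  p \is d.-homog -> q \is e.-homog -> d%:Z = e%:Z + a ->
  (forall x, U x -> evp q x <> 0) -> secO a U (fun x => evp p x / evp q x).
Proof. by move=> hp hq hd hU x Ux; exists d, e, p, q; split=> //; apply: hU. Qed.

Lemma secO_cst U c : secO 0 U (fun=> c).
Proof.
apply: (secO_ext (f := fun x => evp (c *: 1) x / evp 1 x)) => [x _|].
  by rewrite evpZ !evp1 divr1 mulr1.
apply: (@secO_frac _ _ 0 0); rewrite ?rpredZ ?dhomog1 // => x _.
by rewrite evp1; apply/eqP; rewrite oner_eq0.
Qed.

Lemma secO_coord U i : secO 1 U (fun x => x 0 i).
Proof.
apply: (secO_ext (f := fun x => evp 'X_i x / evp 1 x)) => [x _|].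
  by rewrite evpX evp1 divr1.
apply: (@secO_frac _ _ 1 0); rewrite ?dhomog_coord ?dhomog1 // => x _.
by rewrite evp1; apply/eqP; rewrite oner_eq0.
Qed.

Lemma secO_coordV U i :
  (forall x, U x -> x 0 i != 0) -> secO (-1) U (fun x => (x 0 i)^-1).
Proof.
move=> hU; apply: (secO_ext (f := fun x => evp 1 x / evp 'X_i x)) => [x _|].
  by rewrite evpX evp1 div1r.
apply: (@secO_frac _ _ 0 1); rewrite ?dhomog_coord ?dhomog1 // => x /hU/eqP.
by rewrite evpX.
Qed.

Lemma secOD a U f g :
  secO a U f -> secO a U g -> secO a U (fun x => f x + g x).
Proof.
move=> hf hg x Ux.
have [d [e [p [q [hp hq hd hqx E]]]]] := hf x Ux.
have [d' [e' [p' [q' [hp' hq' hd' hqx' E']]]]] := hg x Ux.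
exists (d + e')%N, (e + e')%N, (p * q' + p' * q), (q * q'); split.
- rewrite rpredD //; first exact: dhomogM.
  by have -> : (d + e' = d' + e)%N by [lia]; apply: dhomogM.
- by rewrite dhomogM.
- by lia.
- by rewrite evpM; apply/eqP; rewrite mulf_neq0 //; apply/eqP.
move=> y Uy /eqP; rewrite evpM mulf_eq0 negb_or => /andP[/eqP hy /eqP hy'].
by rewrite E ?E' // evpD !evpM; field; apply/andP; split; apply/eqP.
Qed.

Lemma secOM a b U f g :
  secO a U f -> secO b U g -> secO (a + b) U (fun x => f x * g x).
Proof.
move=> hf hg x Ux.
have [d [e [p [q [hp hq hd hqx E]]]]] := hf x Ux.
have [d' [e' [p' [q' [hp' hq' hd' hqx' E']]]]] := hg x Ux.
exists (d + d')%N, (e + e')%N, (p * p'), (q * q'); split.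
- by rewrite dhomogM.
- by rewrite dhomogM.
- by lia.
- by rewrite evpM; apply/eqP; rewrite mulf_neq0 //; apply/eqP.
move=> y Uy /eqP; rewrite evpM mulf_eq0 negb_or => /andP[/eqP hy /eqP hy'].
by rewrite E ?E' // !evpM; field; apply/andP; split; apply/eqP.
Qed.

Lemma secOM' c a b U f g :
  c = a + b -> secO a U f -> secO b U g -> secO c U (fun x => f x * g x).
Proof. by move->; apply: secOM. Qed.

Lemma secOM0 U f g :
  secO 0 U f -> secO 0 U g -> secO 0 U (fun x => f x * g x).
Proof. by apply: secOM'; rewrite addr0. Qed.

Lemma secOZ a U c f : secO a U f -> secO a U (fun x => c * f x).
Proof. by apply: (@secOM' a 0); [rewrite add0r|apply: secO_cst]. Qed.

(** For negative [a] the denominator must have positive degree and not vanish at [x]: a power of a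
    nonzero coordinate serves, which is why the origin is excluded. *)
Lemma secO0 a U : (forall x, U x -> x != 0) -> secO a U (fun=> 0).
Proof.
move=> U0 x Ux; have /rV0Pn[i xi] := U0 x Ux.
case: a => n.
  exists n, 0%N, 0, 1; rewrite rpred0 dhomog1 evp1 add0r.
  by split=> //; [apply/eqP; rewrite oner_eq0|move=> y _ _; rewrite evp0 mul0r].
exists 0%N, n.+1, 0, ('X_i ^+ n.+1); rewrite rpred0 dhomog_coordX evp_exp evpX.
split=> //; [lia| |by move=> y _ _; rewrite evp0 mul0r].
by apply/eqP; rewrite expf_neq0.
Qed.

Lemma secO_sum a U (I : Type) (s : seq I) (G : I -> pt -> F) :
  (forall x, U x -> x != 0) -> (forall i, secO a U (G i)) ->
  secO a U (fun x => \sum_(i <- s) G i x).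
Proof.
move=> U0 hG; elim: s => [|i s IH].
  by apply: (secO_ext _ (secO0 a U0)) => x _; rewrite big_nil.
by apply: (secO_ext _ (secOD (hG i) IH)) => x _; rewrite big_cons.
Qed.

(** * Bihomogeneous forms and sections on the product *)

Definition mulb (p q : bipoly F r) : bipoly F r :=
  [seq (u.1 * v.1, u.2 * v.2) | u <- p, v <- q].

Lemma evb_cat (p q : bipoly F r) x y :
  evb (p ++ q) x y = evb p x y + evb q x y.
Proof. exact: big_cat. Qed.

Lemma evb_mul (p q : bipoly F r) x y :
  evb (mulb p q) x y = evb p x y * evb q x y.
Proof.
rewrite /evb big_allpairs_dep big_distrl /=; apply: eq_bigr => u _.
by rewrite big_distrr /=; apply: eq_bigr => v _; rewrite !evpM; ring.
Qed.

Lemma evb1 p q x y : evb [:: (p, q)] x y = evp p x * evp q y.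
Proof. exact: big_seq1. Qed.

Lemma bihomog1 d e p q :
  p \is d.-homog -> q \is e.-homog -> bihomog d e [:: (p, q)].
Proof. by move=> hp hq u; rewrite inE => /eqP->. Qed.

Lemma bihomog_cat d e (p q : bipoly F r) :
  bihomog d e p -> bihomog d e q -> bihomog d e (p ++ q).
Proof. by move=> hp hq u; rewrite mem_cat => /orP[/hp|/hq]. Qed.

Lemma bihomog_mul d e d' e' (p q : bipoly F r) :
  bihomog d e p -> bihomog d' e' q -> bihomog (d + d') (e + e') (mulb p q).
Proof.
move=> hp hq u /allpairsP[[v w] /= [/hp[? ?] /hq[? ?] ->]].
by split; apply: dhomogM.
Qed.

Lemma evb_fst (p : bipoly F r) x y :
  evb p x y = evp (\sum_(u <- p) evp u.2 y *: u.1) x.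
Proof.
by rewrite evp_sum; apply: eq_bigr => u _; rewrite evpZ mulrC.
Qed.

Lemma evb_snd (p : bipoly F r) x y :
  evb p x y = evp (\sum_(u <- p) evp u.1 x *: u.2) y.
Proof. by rewrite evp_sum; apply: eq_bigr => u _; rewrite evpZ. Qed.

Lemma dhomog_fst d e (p : bipoly F r) y :
  bihomog d e p -> \sum_(u <- p) evp u.2 y *: u.1 \is d.-homog.
Proof.
by move=> hp; rewrite big_seq rpred_sum // => u /hp[? _]; rewrite rpredZ.
Qed.

Lemma dhomog_snd d e (p : bipoly F r) x :
  bihomog d e p -> \sum_(u <- p) evp u.1 x *: u.2 \is e.-homog.
Proof.
by move=> hp; rewrite big_seq rpred_sum // => u /hp[_ ?]; rewrite rpredZ.
Qed.

Implicit Types (sg tau : pt -> pt -> F).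

Lemma secO2_sub a b W W' sg :
  (forall x y, W' x y -> W x y) -> secO2 a b W sg -> secO2 a b W' sg.
Proof.
move=> sW hs x y W'xy.
have [d1 [d2 [e1 [e2 [p [q [hp hq hd hqx E]]]]]]] := hs x y (sW _ _ W'xy).
by exists d1, d2, e1, e2, p, q; split=> // x' y' /sW; apply: E.
Qed.

Lemma secO2_ext a b W sg tau :
  (forall x y, W x y -> sg x y = tau x y) -> secO2 a b W sg ->
  secO2 a b W tau.
Proof.
move=> st hs x y Wxy.
have [d1 [d2 [e1 [e2 [p [q [hp hq hd hqx E]]]]]]] := hs x y Wxy.
by exists d1, d2, e1, e2, p, q; split=> // x' y' ? ?; rewrite -st //; apply: E.
Qed.

Lemma secO2_frac a b W d1 d2 e1 e2 (p q : bipoly F r) :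
  bihomog d1 d2 p -> bihomog e1 e2 q ->
  d1%:Z = e1%:Z + a -> d2%:Z = e2%:Z + b ->
  (forall x y, W x y -> evb q x y <> 0) ->
  secO2 a b W (fun x y => evb p x y / evb q x y).
Proof.
by move=> ? ? ? ? hW x y Wxy; exists d1, d2, e1, e2, p, q; split=> //; apply: hW.
Qed.

Lemma secO2_fst a U W f :
  (forall x y, W x y -> U x) -> secO a U f -> secO2 a 0 W (fun x _ => f x).
Proof.
move=> sW hf x y Wxy; have [d [e [p [q [hp hq hd hqx E]]]]] := hf x (sW x y Wxy).
exists d, 0%N, e, 0%N, [:: (p, 1)], [:: (q, 1)]; split.
- by apply: bihomog1; rewrite ?dhomog1.
- by apply: bihomog1; rewrite ?dhomog1.
- by [].
- by rewrite evb1 evp1 mulr1.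
by move=> x' y'; rewrite !evb1 !evp1 !mulr1 => /sW; apply: E.
Qed.

Lemma secO2_snd b U W f :
  (forall x y, W x y -> U y) -> secO b U f -> secO2 0 b W (fun _ y => f y).
Proof.
move=> sW hf x y Wxy; have [d [e [p [q [hp hq hd hqx E]]]]] := hf y (sW x y Wxy).
exists 0%N, d, 0%N, e, [:: (1, p)], [:: (1, q)]; split.
- by apply: bihomog1; rewrite ?dhomog1.
- by apply: bihomog1; rewrite ?dhomog1.
- by [].
- by rewrite evb1 evp1 mul1r.
by move=> x' y'; rewrite !evb1 !evp1 !mul1r => /sW; apply: E.
Qed.

Lemma secO2D a b W sg tau :
  secO2 a b W sg -> secO2 a b W tau ->
  secO2 a b W (fun x y => sg x y + tau x y).
Proof.
move=> hf hg x y Wxy.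
have [d1 [d2 [e1 [e2 [p [q [hp hq [hd hd'] hqx E]]]]]]] := hf x y Wxy.
have [c1 [c2 [f1 [f2 [p' [q' [hp' hq' [hc hc'] hqx' E']]]]]]] := hg x y Wxy.
exists (d1 + f1)%N, (d2 + f2)%N, (e1 + f1)%N, (e2 + f2)%N.
exists (mulb p q' ++ mulb p' q), (mulb q q'); split.
- apply: bihomog_cat; first exact: bihomog_mul.
  have -> : (d1 + f1 = c1 + e1)%N by lia.
  have -> : (d2 + f2 = c2 + e2)%N by lia.
  exact: bihomog_mul.
- exact: bihomog_mul.
- by lia.
- by rewrite evb_mul; apply/eqP; rewrite mulf_neq0 //; apply/eqP.
move=> x' y' W' /eqP; rewrite evb_mul mulf_eq0 negb_or => /andP[/eqP h /eqP h'].
by rewrite E ?E' // evb_cat !evb_mul; field; apply/andP; split; apply/eqP.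
Qed.

Lemma secO2M a b a' b' W sg tau :
  secO2 a b W sg -> secO2 a' b' W tau ->
  secO2 (a + a') (b + b') W (fun x y => sg x y * tau x y).
Proof.
move=> hf hg x y Wxy.
have [d1 [d2 [e1 [e2 [p [q [hp hq [hd hd'] hqx E]]]]]]] := hf x y Wxy.
have [c1 [c2 [f1 [f2 [p' [q' [hp' hq' [hc hc'] hqx' E']]]]]]] := hg x y Wxy.
exists (d1 + c1)%N, (d2 + c2)%N, (e1 + f1)%N, (e2 + f2)%N.
exists (mulb p p'), (mulb q q'); split.
- exact: bihomog_mul.
- exact: bihomog_mul.
- by lia.
- by rewrite evb_mul; apply/eqP; rewrite mulf_neq0 //; apply/eqP.
move=> x' y' W' /eqP; rewrite evb_mul mulf_eq0 negb_or => /andP[/eqP h /eqP h'].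
by rewrite E ?E' // !evb_mul; field; apply/andP; split; apply/eqP.
Qed.

Lemma secO2M' a b a1 b1 a2 b2 W sg tau :
  a = a1 + a2 -> b = b1 + b2 -> secO2 a1 b1 W sg -> secO2 a2 b2 W tau ->
  secO2 a b W (fun x y => sg x y * tau x y).
Proof. by move=> -> ->; apply: secO2M. Qed.

Lemma secO2_cst W c : secO2 0 0 W (fun _ _ => c).
Proof. by apply: (secO2_fst (U := fun=> True)) => //; apply: secO_cst. Qed.

Lemma secO2Z a b W c sg :
  secO2 a b W sg -> secO2 a b W (fun x y => c * sg x y).
Proof. by apply: (@secO2M' a b 0 0); [rewrite add0r..|apply: secO2_cst]. Qed.

Lemma secO_fst a b W sg y : secO2 a b W sg -> secO a (W^~ y) (sg^~ y).
Proof.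
move=> hs x Wxy.
have [d1 [d2 [e1 [e2 [p [q [hp hq [hd _] hqx E]]]]]]] := hs x y Wxy.
exists d1, e1, (\sum_(u <- p) evp u.2 y *: u.1),
  (\sum_(u <- q) evp u.2 y *: u.1).
split; rewrite -?evb_fst ?(dhomog_fst _ hp) ?(dhomog_fst _ hq) //.
by move=> x' Wx'; rewrite -!evb_fst; apply: E.
Qed.

Lemma secO_snd a b W sg x : secO2 a b W sg -> secO b (W x) (sg x).
Proof.
move=> hs y Wxy.
have [d1 [d2 [e1 [e2 [p [q [hp hq [_ hd] hqx E]]]]]]] := hs x y Wxy.
exists d2, e2, (\sum_(u <- p) evp u.1 x *: u.2),
  (\sum_(u <- q) evp u.1 x *: u.2).
split; rewrite -?evb_snd ?(dhomog_snd _ hp) ?(dhomog_snd _ hq) //.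
by move=> y' Wy'; rewrite -!evb_snd; apply: E.
Qed.

End Sections.

(** * Zariski topology *)

Section Topology.

Variables (F : closedFieldType) (r : nat).

Notation pt := 'rV[F]_r.+1.
Notation poly := {mpoly F[r.+1]}.

Implicit Types (X U : pt -> Prop) (W : pt -> pt -> Prop) (x y : pt).
Implicit Types (a b : int) (f g : pt -> F) (p q : poly).

Lemma open_sub X U x : open_in X U -> U x -> X x.
Proof. by case=> Z _ hU /hU[]. Qed.

Lemma openI X U1 U2 :
  open_in X U1 -> open_in X U2 -> open_in X (fun x => U1 x /\ U2 x).
Proof.
case=> Z1 [S1 [hS1 hZ1]] hU1 [Z2 [S2 [hS2 hZ2]] hU2].
exists (fun x => Z1 x \/ Z2 x).
  exists (fun p => exists p1 p2, [/\ S1 p1, S2 p2 & p = p1 * p2]); split.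
    move=> p [p1 [p2 [/hS1[d1 h1] /hS2[d2 h2] ->]]].
    by exists (d1 + d2)%N; apply: dhomogM.
  move=> x; split=> [[/hZ1|/hZ2] [x0 hp]|[x0 hp]].
  - by split=> // p [p1 [p2 [/hp h _ ->]]]; rewrite evpM h mul0r.
  - by split=> // p [p1 [p2 [_ /hp h ->]]]; rewrite evpM h mulr0.
  apply: contrapT => /not_orP[/hZ1/not_andP[//|n1] /hZ2/not_andP[//|n2]].
  move/existsNP: n1 => [p1 /not_implyP[s1 /eqP n1]].
  move/existsNP: n2 => [p2 /not_implyP[s2 /eqP n2]].
  have := mulf_neq0 n1 n2; rewrite -evpM => /eqP; apply.
  by apply: hp; exists p1, p2.
move=> x; split=> [[/hU1[Xx n1] /hU2[_ n2]]|[Xx n]]; first by split=> // -[].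
by split; [apply/hU1|apply/hU2]; split=> // z; apply: n; [left|right].
Qed.

Lemma open_ne X d p : (forall x, X x -> x != 0) -> p \is d.-homog ->
  open_in X (fun x => X x /\ evp p x <> 0).
Proof.
move=> X0 hp; exists (fun x => x != 0 /\ evp p x = 0).
  exists (fun q => q = p); split=> [q ->|x]; first by exists d.
  by split=> -[x0 h]; split=> //; [move=> q ->|apply: h].
move=> x; split=> -[Xx h]; split=> //; first by case.
by move=> px; apply: h; split=> //; apply: X0.
Qed.

Lemma open_self X : (forall x, X x -> x != 0) -> open_in X X.
Proof.
move=> X0; have [Z zZ hZ] := open_ne X0 (dhomog1 F (@mdeg r.+1)).
exists Z => // x; rewrite -hZ evp1; split=> [Xx|[]//].
by split=> //; apply/eqP; rewrite oner_eq0.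
Qed.

Lemma open_meet X U1 U2 : irreducible X ->
  open_in X U1 -> (exists x, U1 x) -> open_in X U2 -> (exists x, U2 x) ->
  exists x, U1 x /\ U2 x.
Proof.
move=> [_ irr] [Z1 z1 h1] [x1 U1x] [Z2 z2 h2] [x2 U2x].
apply: contrapT => n.
have [x Xx|s|s] := irr Z1 Z2 z1 z2 _.
- apply: contrapT => /not_orP[n1 n2]; apply: n; exists x.
  by split; [apply/h1|apply/h2].
- by move/h1: U1x => [Xx []]; apply: s.
- by move/h2: U2x => [Xx []]; apply: s.
Qed.

Lemma open_bigI X n (U : 'I_n -> pt -> Prop) : irreducible X ->
  (forall x, X x -> x != 0) ->
  (forall i, open_in X (U i)) -> (forall i, exists x, U i x) ->
  exists V, [/\ open_in X V, exists x, V x & forall i x, V x -> U i x].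
Proof.
move=> irr X0 hU neU.
have H (s : seq 'I_n) :
    exists V, [/\ open_in X V, exists x, V x & forall i x, i \in s -> V x -> U i x].
  elim: s => [|i s [V [oV nV hV]]].
    by exists X; split=> //; [apply: open_self|case: irr].
  exists (fun x => U i x /\ V x); split; first exact: openI.
    exact: (open_meet irr).
  by move=> j x; rewrite inE => /orP[/eqP-> []//|js] [_]; apply: hV.
have [V [oV nV hV]] := H (enum 'I_n).
by exists V; split=> // i x; apply: hV; rewrite mem_enum.
Qed.

(** Identity principle: a section that is p/q near [x] and nonzero there is nonzero on the open set
    where p and q do not vanish, and by irreducibility this set meets [U0]. *)
Lemma secO_eq0 X U U0 a f : irreducible X -> (forall x, X x -> x != 0) ->
  open_in X U -> open_in X U0 -> (exists x, U0 x) -> secO a U f ->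
  (forall x, U x -> U0 x -> f x = 0) -> forall x, U x -> f x = 0.
Proof.
move=> irr X0 oU oU0 neU0 hf f0 x Ux.
have [d [e [p [q [hp hq hd qx E]]]]] := hf x Ux; apply: contrapT => fx.
have px : evp p x <> 0 by move=> px; apply: fx; rewrite E // px mul0r.
have Xx := open_sub oU Ux.
have oV := openI oU (openI (open_ne X0 hp) (open_ne X0 hq)).
have [y [[Uy [[_ py] [_ qy]]] U0y]] :
    exists y, (U y /\ (X y /\ evp p y <> 0) /\ (X y /\ evp q y <> 0)) /\ U0 y.
  by apply: (open_meet irr oV) => //; exists x.
have /eqP := f0 y Uy U0y; rewrite E // mulf_eq0 invr_eq0.
by case/orP=> /eqP.
Qed.

(** * Open subsets of the product *)

Lemma open2_sub X W x y : open_in2 X W -> W x y -> X x /\ X y.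
Proof. by case=> S [_ hW] /hW[]. Qed.

Lemma open2I X W1 W2 :
  open_in2 X W1 -> open_in2 X W2 -> open_in2 X (fun x y => W1 x y /\ W2 x y).
Proof.
case=> S1 [hS1 hW1] [S2 [hS2 hW2]].
exists (fun p : bipoly F r => exists p1 p2 : bipoly F r,
  [/\ S1 p1, S2 p2 & p = mulb p1 p2]); split.
  move=> p [p1 [p2 [/hS1[d1 [e1 h1]] /hS2[d2 [e2 h2]] ->]]].
  by exists (d1 + d2)%N, (e1 + e2)%N; apply: bihomog_mul.
move=> x y; split.
  move=> [/hW1[Xx Xy [p1 s1 /eqP n1]] /hW2[_ _ [p2 s2 /eqP n2]]]; split=> //.
  exists (mulb p1 p2); first by exists p1, p2.
  by rewrite evb_mul; apply/eqP; rewrite mulf_neq0.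
move=> [Xx Xy [p [p1 [p2 [s1 s2 ->]]] /eqP]].
rewrite evb_mul mulf_eq0 negb_or => /andP[/eqP n1 /eqP n2].
by split; [apply/hW1; split=> //; exists p1|apply/hW2; split=> //; exists p2].
Qed.

Lemma open2_prod X U1 U2 : (forall x, X x -> x != 0) ->
  open_in X U1 -> open_in X U2 -> open_in2 X (fun x y => U1 x /\ U2 y).
Proof.
move=> X0 [Z1 [S1 [hS1 hZ1]] hU1] [Z2 [S2 [hS2 hZ2]] hU2].
exists (fun p : bipoly F r => exists p1 p2,
  [/\ S1 p1, S2 p2 & p = [:: (p1, p2)]]); split.
  move=> p [p1 [p2 [/hS1[d h1] /hS2[e h2] ->]]]; exists d, e.
  exact: bihomog1.
have H x (Z : pt -> Prop) (S : poly -> Prop) :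
    (forall x, Z x <-> x != 0 /\ forall p, S p -> evp p x = 0) ->
    X x -> ~ Z x -> exists2 p, S p & evp p x != 0.
  move=> hZ Xx nZ; apply: contrapT => n; apply/nZ/hZ; split; first exact: X0.
  by move=> p Sp; apply/eqP; apply: contrapT => /negP ?; apply: n; exists p.
move=> x y; split.
  move=> [/hU1[Xx /(H x _ _ hZ1 Xx)[p1 s1 n1]] /hU2[Xy /(H y _ _ hZ2 Xy)[p2 s2 n2]]].
  split=> //; exists [:: (p1, p2)]; first by exists p1, p2.
  by rewrite evb1; apply/eqP; rewrite mulf_neq0.
move=> [Xx Xy [p [p1 [p2 [s1 s2 ->]]] /eqP]].
rewrite evb1 mulf_eq0 negb_or => /andP[/eqP n1 /eqP n2].
split; [apply/hU1|apply/hU2]; split=> //.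
  by move/hZ1=> [_ /(_ _ s1)].
by move/hZ2=> [_ /(_ _ s2)].
Qed.

Lemma open2_ne X d e (p : bipoly F r) : bihomog d e p ->
  open_in2 X (fun x y => [/\ X x, X y & evb p x y <> 0]).
Proof.
move=> hp; exists (fun q : bipoly F r => q = p).
split=> [q ->|x y]; first by exists d, e.
by split=> [[? ? ?]|[? ? [q -> ?]]]; split=> //; exists p.
Qed.

Lemma open2_basis X W x y : open_in2 X W -> W x y ->
  exists d e (p : bipoly F r), [/\ bihomog d e p, evb p x y <> 0
    & forall x' y', X x' -> X y' -> evb p x' y' <> 0 -> W x' y'].
Proof.
case=> S [hS hW] /hW[Xx Xy [p Sp px]]; have [d [e hp]] := hS p Sp.
by exists d, e, p; split=> // x' y' ? ? ?; apply/hW; split=> //; exists p.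
Qed.

Lemma open_fst X W y : (forall x, X x -> x != 0) ->
  open_in2 X W -> X y -> open_in X (W^~ y).
Proof.
move=> X0 [S [hS hW]] Xy.
exists (fun x => x != 0 /\ forall p : bipoly F r, S p -> evb p x y = 0).
  exists (fun q => exists2 p : bipoly F r, S p & q = \sum_(u <- p) evp u.2 y *: u.1).
  split=> [q [p /hS[d [e hp]] ->]|x]; first by exists d; apply: dhomog_fst hp.
  split=> -[x0 h]; split=> //; first by move=> q [p /h hp ->]; rewrite -evb_fst.
  by move=> p Sp; rewrite evb_fst; apply: h; exists p.
move=> x; split=> [/hW[Xx _ [p Sp n]]|[Xx n]].
  by split=> // -[_ /(_ _ Sp)].
apply/hW; split=> //; apply: contrapT => m; apply: n; split; first exact: X0.
by move=> p Sp; apply: contrapT => ?; apply: m; exists p.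
Qed.

Lemma open_snd X W x : (forall x, X x -> x != 0) ->
  open_in2 X W -> X x -> open_in X (W x).
Proof.
move=> X0 [S [hS hW]] Xx.
exists (fun y => y != 0 /\ forall p : bipoly F r, S p -> evb p x y = 0).
  exists (fun q => exists2 p : bipoly F r, S p & q = \sum_(u <- p) evp u.1 x *: u.2).
  split=> [q [p /hS[d [e hp]] ->]|y]; first by exists e; apply: dhomog_snd hp.
  split=> -[y0 h]; split=> //; first by move=> q [p /h hp ->]; rewrite -evb_snd.
  by move=> p Sp; rewrite evb_snd; apply: h; exists p.
move=> y; split=> [/hW[_ Xy [p Sp n]]|[Xy n]].
  by split=> // -[_ /(_ _ Sp)].
apply/hW; split=> //; apply: contrapT => m; apply: n; split; first exact: X0.
by move=> p Sp; apply: contrapT => ?; apply: m; exists p.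
Qed.

(** A fraction p/q valid only on [W0] becomes one valid wherever its denominator is nonzero, once p
    and q are multiplied by a form h whose nonvanishing locus lies in [W0]. *)
Lemma secO2_local X a b W (sg : pt -> pt -> F) :
  (forall x y, W x y -> X x /\ X y) ->
  (forall x y, W x y -> exists W0,
     [/\ open_in2 X W0, W0 x y & secO2 a b (fun x y => W x y /\ W0 x y) sg]) ->
  secO2 a b W sg.
Proof.
move=> WX H x y Wxy; have [W0 [oW0 W0xy hs]] := H x y Wxy.
have [d [e [h [hh hxy hW]]]] := open2_basis oW0 W0xy.
have [d1 [d2 [e1 [e2 [p [q [hp hq [hd hd'] hqx E]]]]]]] := hs x y (conj Wxy W0xy).
exists (d1 + d)%N, (d2 + e)%N, (e1 + d)%N, (e2 + e)%N, (mulb p h), (mulb q h).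
split.
- exact: bihomog_mul.
- exact: bihomog_mul.
- by lia.
- by rewrite evb_mul; apply/eqP; rewrite mulf_neq0 //; apply/eqP.
move=> x' y' W' /eqP; rewrite evb_mul mulf_eq0 negb_or => /andP[/eqP q' /eqP h'].
have [Xx' Xy'] := WX _ _ W'.
rewrite E //; last by split=> //; apply: hW.
by rewrite !evb_mul; field; apply/andP; split; apply/eqP.
Qed.

End Topology.

(** * Powers of the ideal of the diagonal *)

Section PrincipalParts.

Variables (F : closedFieldType) (r : nat).

Notation pt := 'rV[F]_r.+1.

Implicit Types (X U : pt -> Prop) (W : pt -> pt -> Prop) (x y : pt).
Implicit Types (a b : int) (m : nat) (sg tau g : pt -> pt -> F).

Definition Ipow_on m a b W sg : Prop :=
  exists N (g : 'I_N -> 'I_m -> pt -> pt -> F) t, Ipow_expr a b W g t sg.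

Lemma Ipow_on_ext m a b W sg tau :
  (forall x y, W x y -> sg x y = tau x y) -> Ipow_on m a b W sg ->
  Ipow_on m a b W tau.
Proof.
move=> st [N [g [t [hg ht E]]]]; exists N, g, t; split=> // x y Wxy.
by rewrite -st // E.
Qed.

Lemma Ipow_on_sub m a b W W' sg :
  (forall x y, W' x y -> W x y) -> Ipow_on m a b W sg -> Ipow_on m a b W' sg.
Proof.
move=> sW [N [g [t [hg ht E]]]]; exists N, g, t; split.
- move=> j i; have [h1 h2] := hg j i.
  by split; [apply: secO2_sub sW h1|move=> x /sW; apply: h2].
- by move=> j; apply: secO2_sub sW (ht j).
by move=> x y /sW; apply: E.
Qed.

Lemma Ipow_on_nil m a b W : Ipow_on m a b W (fun _ _ => 0).
Proof.
exists 0%N, (fun _ _ _ _ => 0), (fun _ _ _ => 0).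
by split=> [[]|[]|x y _] //; rewrite big_ord0.
Qed.

Lemma Ipow_on0 a b W sg : secO2 a b W sg -> Ipow_on 0 a b W sg.
Proof.
move=> hs; exists 1%N, (fun _ _ _ _ => 0), (fun _ => sg).
by split=> [_ []| |x y _] //; rewrite big_ord1 big_ord0 mul1r.
Qed.

Lemma Ipow_onD m a b W sg tau :
  Ipow_on m a b W sg -> Ipow_on m a b W tau ->
  Ipow_on m a b W (fun x y => sg x y + tau x y).
Proof.
move=> [N [g [t [hg ht E]]]] [N' [g' [t' [hg' ht' E']]]].
exists (N + N')%N,
  (fun j => match split j with inl j => g j | inr j => g' j end),
  (fun j => match split j with inl j => t j | inr j => t' j end); split.
- by move=> j i; case: (split j).
- by move=> j; case: (split j).
move=> x y Wxy; rewrite E // E' // big_split_ord /=.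
congr (_ + _); apply: eq_bigr => j _.
  by rewrite -[lshift _ _]/(unsplit (inl _)) unsplitK.
by rewrite -[rshift _ _]/(unsplit (inr _)) unsplitK.
Qed.

Lemma Ipow_onM m a b a' b' W sg h :
  secO2 a' b' W h -> Ipow_on m a b W sg ->
  Ipow_on m (a' + a) (b' + b) W (fun x y => h x y * sg x y).
Proof.
move=> hh [N [g [t [hg ht E]]]].
exists N, g, (fun j x y => h x y * t j x y); split=> // [j|x y Wxy].
  exact: secO2M.
by rewrite E // mulr_sumr; apply: eq_bigr => j _; rewrite mulrCA.
Qed.

Lemma Ipow_onS m a b W sg g :
  idealDelta W g -> Ipow_on m a b W sg ->
  Ipow_on m.+1 a b W (fun x y => g x y * sg x y).
Proof.
move=> hh [N [h [t [hg ht E]]]].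
exists N, (fun j i => oapp (h j) g (unlift ord0 i)), t; split=> // [j i|x y Wxy].
  by case: (unlift ord0 i) => /=.
rewrite E // mulr_sumr; apply: eq_bigr => j _.
rewrite big_ord_recl unlift_none /= mulrA; congr (_ * _ * _).
by apply: eq_bigr => i _; rewrite liftK.
Qed.

(** Induction over sums of products of sections of the ideal; the order [m] is an argument of [Q]
    because it grows with each factor. *)
Lemma Ipow_on_ind a b W (Q : nat -> (pt -> pt -> F) -> Prop) :
  (forall m sg tau, (forall x y, W x y -> sg x y = tau x y) ->
     Q m sg -> Q m tau) ->
  (forall sg, secO2 a b W sg -> Q 0%N sg) ->
  (forall m, Q m (fun _ _ => 0)) ->
  (forall m sg tau, Q m sg -> Q m tau -> Q m (fun x y => sg x y + tau x y)) ->
  (forall m g sg, idealDelta W g -> Q m sg ->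
     Q m.+1 (fun x y => g x y * sg x y)) ->
  forall m sg, Ipow_on m a b W sg -> Q m sg.
Proof.
move=> Qext Q0 Qnil QD QS m sg [N [g [t [hg ht E]]]].
have QM n (h : 'I_n -> pt -> pt -> F) tau : (forall i, idealDelta W (h i)) ->
    secO2 a b W tau -> Q n (fun x y => (\prod_(i < n) h i x y) * tau x y).
  move=> hh htau; elim: n h hh => [|n IH] h hh.
    by apply: (Qext _ tau); [move=> x y _; rewrite big_ord0 mul1r|apply: Q0].
  apply: Qext (QS _ _ _ (hh ord0) (IH _ (fun i => hh (lift ord0 i)))) => x y _.
  by rewrite big_ord_recl mulrA.
apply: (Qext _ (fun x y => \sum_(j < N) (\prod_(i < m) g j i x y) * t j x y)).
  by move=> x y /E.
elim: (index_enum _) => [|j s IH].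
  by apply: Qext (Qnil m) => x y _; rewrite big_nil.
by apply: Qext (QD _ _ _ (QM _ _ _ (hg j) (ht j)) IH) => x y _; rewrite big_cons.
Qed.

Lemma Ipow_on_pred m a b W sg : Ipow_on m.+1 a b W sg -> Ipow_on m a b W sg.
Proof.
(* One factor of each product is absorbed into the coefficient. For n = 0 both conjuncts agree, as
   [0.-1] is 0. *)
pose Q n tau := Ipow_on n a b W tau /\ Ipow_on n.-1 a b W tau.
move=> hs; suff: Q m.+1 sg by case.
apply: Ipow_on_ind hs => {m sg}.
- by move=> m sg tau st [h1 h2]; split; apply: Ipow_on_ext st _.
- by move=> sg hs; split; apply: Ipow_on0.
- by move=> m; split; apply: Ipow_on_nil.
- by move=> m sg tau [? ?] [? ?]; split; apply: Ipow_onD.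
move=> m g sg hg [h1 h2]; split; first exact: Ipow_onS.
by have := Ipow_onM hg.1 h1; rewrite !add0r.
Qed.

Lemma Ipow_ext X m a b x sg tau :
  (forall y z, sg y z = tau y z) -> Ipow X m a b x sg -> Ipow X m a b x tau.
Proof.
move=> st [W [oW Wx h]]; exists W; split=> //.
exact: Ipow_on_ext (fun y z _ => st y z) h.
Qed.

Lemma IpowD X m a b x sg tau :
  Ipow X m a b x sg -> Ipow X m a b x tau ->
  Ipow X m a b x (fun y z => sg y z + tau y z).
Proof.
move=> [W [oW Wx h]] [W' [oW' Wx' h']].
exists (fun y z => W y z /\ W' y z); split=> //; first exact: open2I.
by apply: Ipow_onD; [apply: Ipow_on_sub h|apply: Ipow_on_sub h'] => y z [].
Qed.

Lemma IpowZ X U m a b c x f sg : (forall x, X x -> x != 0) ->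
  open_in X U -> U x -> secO c U f -> Ipow X m a b x sg ->
  Ipow X m (c + a) b x (fun y z => f y * sg y z).
Proof.
move=> X0 oU Ux hf [W [oW Wx h]].
exists (fun y z => W y z /\ (U y /\ U z)); split=> //.
  by apply: open2I => //; apply: open2_prod.
rewrite -[b]add0r; apply: Ipow_onM; last by apply: Ipow_on_sub h => y z [].
by apply: secO2_fst hf => y z [_ []].
Qed.

Implicit Types (s t : pt -> 'cV[F]_r.+1).

Lemma ker_taylor_sub X k a U U' s : (forall x, U' x -> U x) ->
  ker_taylor X k a U s -> ker_taylor X k a U' s.
Proof.
move=> sU [h1 h2]; split=> [i|x /sU]; last exact: h2.
exact: secO_sub sU (h1 i).
Qed.

Lemma ker_taylorD X k a U s t :
  ker_taylor X k a U s -> ker_taylor X k a U t ->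
  ker_taylor X k a U (fun x => s x + t x).
Proof.
move=> [h1 h2] [h1' h2']; split=> [i|x Ux].
  by apply: (secO_ext _ (secOD (h1 i) (h1' i))) => x _; rewrite mxE.
apply: Ipow_ext (IpowD (h2 x Ux) (h2' x Ux)) => y z.
by rewrite /taylor mulmxDr [RHS]mxE.
Qed.

Lemma ker_taylorZ X k a c c' U f s : (forall x, X x -> x != 0) ->
  open_in X U -> c' = c + a -> secO c U f -> ker_taylor X k a U s ->
  ker_taylor X k c' U (fun x => f x *: s x).
Proof.
move=> X0 oU -> hf [h1 h2]; split=> [i|x Ux].
  by apply: (secO_ext _ (secOM hf (h1 i))) => x _; rewrite mxE.
apply: Ipow_ext (IpowZ X0 oU Ux hf (h2 x Ux)) => y z.
by rewrite /taylor -scalemxAr [RHS]mxE.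
Qed.

Lemma ker_taylor0 X k a U : (forall x, X x -> x != 0) -> open_in X U ->
  ker_taylor X k a U (fun=> 0).
Proof.
move=> X0 oU; split=> [i|x Ux].
  apply: (secO_ext (f := fun=> 0)); first by move=> x _; rewrite mxE.
  by apply: secO0 => x /(open_sub oU)/X0.
exists (fun y z => U y /\ U z); split=> //; first exact: open2_prod.
apply: Ipow_on_ext (@Ipow_on_nil _ _ _ _) => y z _.
by rewrite /taylor mulmx0 mxE.
Qed.

Lemma ker_taylor_sum X k a U n (t : 'I_n -> pt -> 'cV[F]_r.+1) :
  (forall x, X x -> x != 0) -> open_in X U ->
  (forall i, ker_taylor X k a U (t i)) ->
  ker_taylor X k a U (fun x => \sum_i t i x).
Proof.
move=> X0 oU ht; elim: (index_enum _) => [|i l IH].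
  under [X in ker_taylor _ _ _ _ X]eq_fun => x do rewrite big_nil.
  exact: ker_taylor0.
under [X in ker_taylor _ _ _ _ X]eq_fun => x do rewrite big_cons.
exact: ker_taylorD.
Qed.

Lemma ker_taylor_ext X k a U s t : open_in X U -> (forall x, X x -> x != 0) ->
  (forall x, U x -> s x = t x) ->
  ker_taylor X k a U s -> ker_taylor X k a U t.
Proof.
move=> oU X0 st [h1 h2]; split=> [i|x Ux].
  by apply: (secO_ext _ (h1 i)) => x /st->.
have [W [oW Wx h]] := h2 x Ux.
exists (fun y z => W y z /\ (U y /\ U z)); split=> //.
  by apply: open2I => //; apply: open2_prod.
apply: (@Ipow_on_ext _ _ _ _ (taylor s)) => [y z [_ [Uy _]]|].
  by rewrite /taylor st.
by apply: Ipow_on_sub h => y z [].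
Qed.

Lemma ker_taylor_pred X k a U s :
  ker_taylor X k.+1 a U s -> ker_taylor X k a U s.
Proof.
move=> [h1 h2]; split=> // x /h2[W [oW Wx h]]; exists W; split=> //.
exact: Ipow_on_pred h.
Qed.

End PrincipalParts.

(** * A generic frame of the osculating spaces *)

Section Frame.

Variables (F : closedFieldType) (r : nat).

Notation pt := 'rV[F]_r.+1.

Implicit Types (X U : pt -> Prop) (x y v : pt) (k m : nat).

Lemma hatT_sub X k x U (s : pt -> 'cV[F]_r.+1) v :
  hatT X k x v -> open_in X U -> U x -> ker_taylor X k 0 U s ->
  (v *m s x) 0 0 = 0.
Proof. by move=> hv oU Ux; apply: hv. Qed.

(* A basis s of the generic stalk of P_k has coordinates f on the standard     *)
(* basis of V; both remain dual to each other on an open set.                  *)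
Lemma generic_frame X k m : irreducible X -> (forall x, X x -> x != 0) ->
  rankP X k m ->
  exists U (B : pt -> 'M[F]_(m, r.+1)) (S : pt -> 'M[F]_(r.+1, m)),
    [/\ open_in X U, exists x, U x,
        (forall i j, secO 0 U (fun x => B x i j)) /\
        (forall i j, secO 0 U (fun x => S x i j)),
        forall x, U x -> B x *m S x = 1%:M
      & forall x, U x -> forall v, hatT X k x v <-> (v <= B x)%MS].
Proof.
move=> irr X0 [U [s [oU [x0 Ux0] hs indep span]]].
have /rV0Pn[i0 x0i0] := X0 _ (open_sub oU Ux0).
pose U0 x := U x /\ (X x /\ evp 'X_i0 x <> 0).
have oU0 : open_in X U0 by apply: openI oU (open_ne X0 (dhomog_coord F i0)).
have neU0 : exists x, U0 x.
  by exists x0; split=> //; split; [apply: open_sub Ux0|rewrite evpX; apply/eqP].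
have U0nz x : U0 x -> x 0 i0 != 0 by case=> _ [_]; rewrite evpX => /eqP.
(* The twist by the inverse of x_i0 makes the standard basis vector a section of V (x) O(-1), where
   the basis [s] lives. *)
pose t i x : 'cV[F]_r.+1 := (x 0 i0)^-1 *: delta_mx i 0.
have ht i : secV (-1) U0 (t i).
  move=> j; have := secOZ (@delta_mx F r.+1 1 i 0 j 0) (secO_coordV U0nz).
  by apply: secO_ext => x _; rewrite /t [in RHS]mxE mulrC.
have /fin_all_exists[V /fin_all_exists[f hf]] i :
    exists V (f : 'I_m -> pt -> F), [/\ open_in X V, exists x, V x,
      forall x, V x -> U x /\ U0 x, forall j, secO 0 V (f j)
      & secR X k V (fun x => t i x - \sum_j f j x *: s j x)].
  exact: span.
have [U2 [oU2 neU2 sU2]] :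
    exists U2, [/\ open_in X U2, exists x, U2 x & forall i x, U2 x -> V i x].
  by apply: open_bigI => // i; case: (hf i).
have sU20 x : U2 x -> U0 x by move=> /(sU2 ord0) Vx; case: (hf ord0) => _ _ /(_ x Vx)[].
have sU2U x : U2 x -> U x by move=> /sU20[].
have U2nz x : U2 x -> x 0 i0 != 0 by move=> /sU20/U0nz.
have hfO i j : secO 0 U2 (f i j).
  by case: (hf i) => _ _ _ h _; apply: secO_sub (sU2 i) (h j).
have hfR i : secR X k U2 (fun x => t i x - \sum_j f i j x *: s j x).
  by case: (hf i) => _ _ _ _; apply: ker_taylor_sub (sU2 i).
have hsO j : secV (-1) U2 (s j) by move=> i; apply: secO_sub sU2U (hs j i).
have sum_t x (c : 'cV[F]_r.+1) : U2 x -> \sum_i (x 0 i0 * c i 0) *: t i x = c.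
  move=> /U2nz xi; apply/colP => i; rewrite summxE (bigD1 i) //= big1 ?addr0.
    by rewrite !mxE !eqxx mulr1 mulrAC divff ?mul1r.
  by move=> j ji; rewrite !mxE eq_sym (negbTE ji) /= !mulr0.
(* Coordinates of [c] on [s] modulo R_k: expand [c] on the [t i], then each [t i] on [s]. *)
pose coor (c : pt -> 'cV[F]_r.+1) j x := \sum_i (x 0 i0 * c x i 0) * f i j x.
have coorO U' c j : open_in X U' -> (forall x, U' x -> U2 x) ->
    secV (-1) U' c -> secO 0 U' (coor c j).
  move=> oU' sU' hc; apply: secO_sum => [x /(open_sub oU')/X0//|i].
  apply: secOM'; first by rewrite [RHS]addr0.
    by apply: (@secOM' _ _ 0 1 (-1)); [rewrite subrr|apply: secO_coord|apply: hc].
  exact: secO_sub sU' (hfO i j).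
have coorP U' c : open_in X U' -> (forall x, U' x -> U2 x) ->
    secV (-1) U' c ->
    secR X k U' (fun x => c x - \sum_j coor c j x *: s j x).
  move=> oU' sU' hc.
  pose u i x := (x 0 i0 * c x i 0) *: (t i x - \sum_j f i j x *: s j x).
  have hu i : ker_taylor X k (-1) U' (u i).
    apply: (@ker_taylorZ _ _ _ _ (-1) 0) => //.
      by apply: (@secOM' _ _ 0 1 (-1)); [rewrite subrr|apply: secO_coord|apply: hc].
    exact: ker_taylor_sub sU' (hfR i).
  apply: (ker_taylor_ext oU' X0 _ (ker_taylor_sum X0 oU' hu)) => x U'x.
  rewrite /u.
  under eq_bigr => i _ do rewrite scalerBr.
  rewrite sumrB (sum_t _ _ (sU' _ U'x)); congr (_ - _).
  under eq_bigr => i _ do rewrite scaler_sumr.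
  rewrite exchange_big; apply: eq_bigr => j _ /=.
  by rewrite scaler_suml; apply: eq_bigr => i _; rewrite scalerA.
have coor0 U' c : open_in X U' -> (exists x, U' x) ->
    (forall x, U' x -> U2 x) -> secR X k U' c ->
    forall j x, U' x -> coor c j x = 0.
  move=> oU' neU' sU' hc; apply: (indep U') => //.
  - by move=> x /sU'/sU2U.
  - by move=> j; apply: coorO => //; case: hc.
  have := coorP U' c oU' sU' hc.1.
  move=> /(ker_taylorZ X0 oU' (esym (add0r _)) (secO_cst (-1)))/(ker_taylorD hc).
  apply: ker_taylor_ext => // x _.
  by rewrite scaleN1r opprB addrC subrK.
exists U2, (fun x => \matrix_(j, i) f i j x),
  (fun x => \matrix_(i, j) (x 0 i0 * s j x i 0)).
(* The coordinates of [s l] on [s] itself must be Kronecker deltas, by independence of [s] modulo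
   R_k. *)
have hBS x : U2 x -> (\matrix_(j, i) f i j x) *m
    (\matrix_(i, j) (x 0 i0 * s j x i 0)) = 1%:M :> 'M[F]_m.
  move=> U2x; apply/matrixP => j l; rewrite !mxE.
  pose c j' x := coor (s l) j' x - (j' == l)%:R.
  suff /(_ _ U2x)/eqP : forall x, U2 x -> c j x = 0.
    rewrite subr_eq0 => /eqP <-; apply: eq_bigr => i _.
    by rewrite !mxE mulrC.
  apply: (indep U2) => //.
    move=> j'; apply: secOD; first exact: (coorO U2).
    exact: secO_cst.
  have := coorP U2 (s l) oU2 (fun _ h => h) (hsO l).
  move=> /(ker_taylorZ X0 oU2 (esym (add0r _)) (secO_cst (-1))).
  apply: ker_taylor_ext => // y _; rewrite scaleN1r opprB.
  under [RHS]eq_bigr => i _ do rewrite /c scalerBl.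
  rewrite sumrB; congr (_ - _); rewrite (bigD1 l) //= eqxx scale1r big1 ?addr0 //.
  by move=> i /negbTE->; rewrite scale0r.
split=> //.
  split=> i j; first by apply: (secO_ext _ (hfO j i)) => x _; rewrite mxE.
  have : secO 0 U2 (fun x => x 0 i0 * s j x i 0).
    by apply: (@secOM' _ _ 0 1 (-1)); [rewrite subrr|apply: secO_coord|apply: hsO].
  by apply: secO_ext => x _; rewrite mxE.
(* A vector of [hatT] kills e_i - x_i0 sum_j f_ij s_j, which lies in ker alpha_k; this expresses its
   i-th entry by its pairings with the x_i0 s_j. Conversely, the rows of B kill ker alpha_k, since
   by independence its sections have zero coordinates. *)
move=> x U2x v; split=> [hv|/submxP[w ->] U' c [oU' U'x] hc].
  apply/submxP; exists (v *m \matrix_(i, j) (x 0 i0 * s j x i 0)).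
  apply/rowP => i.
  have hk : ker_taylor X k 0 U2
      (fun x => x 0 i0 *: (t i x - \sum_j f i j x *: s j x)).
    by apply: (ker_taylorZ X0 oU2 _ (@secO_coord _ _ _ i0) (hfR i)).
  have := hatT_sub hv oU2 U2x hk; rewrite scalerBr scalerA divff ?U2nz // scale1r.
  rewrite mulmxBr mxE => /eqP; rewrite [X in _ + X]mxE subr_eq0 => /eqP.
  have -> : (v *m (delta_mx i 0 : 'cV_r.+1)) 0 0 = v 0 i.
    by rewrite -colE mxE.
  move=> ->; rewrite scaler_sumr mulmx_sumr summxE [RHS]mxE.
  apply: eq_bigr => j _; rewrite scalerA -scalemxAr [LHS]mxE !mxE.
  rewrite mulr_sumr mulr_suml; apply: eq_bigr => l _.
  by rewrite !mxE; ring.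
pose U3 y := U' y /\ U2 y.
have oU3 : open_in X U3 by apply: openI.
have U3x : U3 x by [].
have hc' : secR X k U3 (fun y => (y 0 i0)^-1 *: c y).
  apply: (@ker_taylorZ _ _ _ _ 0 (-1)) => //; last first.
    by apply: ker_taylor_sub hc => y [].
  by apply: secO_coordV => y [_ /U2nz].
rewrite -mulmxA mxE big1 // => j _; rewrite [X in _ * X]mxE.
suff -> : \sum_i (\matrix_(j, i) f i j x) j i * c x i 0 = 0 by rewrite mulr0.
rewrite -[RHS](coor0 U3 _ oU3 (ex_intro _ x U3x) (fun y h => h.2) hc' j x U3x).
apply: eq_bigr => i _; rewrite !mxE mulrA divff ?mul1r ?U2nz // mulrC.
by [].
Qed.

End Frame.

(** * Vector fields and jets along their flow *)

Section VectorFields.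

Variables (F : closedFieldType) (r : nat).

Notation pt := 'rV[F]_r.+1.

Implicit Types (X U : pt -> Prop) (x y : pt) (f g : pt -> F).

Lemma vector_field_sub X U U' D : (forall y, U' y -> U y) ->
  vector_field X U D -> vector_field X U' D.
Proof. by move=> sU hD V oV sV; apply: hD => // y /sV/sU. Qed.

Section Calculus.

Variables (X U : pt -> Prop) (D : (pt -> F) -> pt -> F).
Hypotheses (oU : open_in X U) (hD : vector_field X U D).

Let hDU f g (hf : secO 0 U f) (hg : secO 0 U g) := hD oU (fun _ h => h) hf hg.

Lemma vf_secO f : secO 0 U f -> secO 0 U (D f).
Proof. by move=> hf; case: (hDU hf hf). Qed.

Lemma vf_ext f g y : secO 0 U f -> (forall z, U z -> f z = g z) -> U y ->
  D f y = D g y.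
Proof.
move=> hf fg; have hg : secO 0 U g by apply: secO_ext hf.
by case: (hDU hf hg) => _ h _ _; apply: h.
Qed.

Lemma vfM f g y : secO 0 U f -> secO 0 U g -> U y ->
  D (fun z => f z * g z) y = f y * D g y + g y * D f y.
Proof. by move=> hf hg; case: (hDU hf hg) => _ _ _; apply. Qed.

Lemma vfD f g y : secO 0 U f -> secO 0 U g -> U y ->
  D (fun z => f z + g z) y = D f y + D g y.
Proof.
move=> hf hg Uy; case: (hDU hf hg) => _ _ /(_ 1 y Uy) h _; move: h.
rewrite mul1r => <-; apply: vf_ext => //; first exact: secOD.
by move=> z _; rewrite mul1r.
Qed.

Lemma vf0 y : U y -> D (fun=> 0) y = 0.
Proof.
move=> Uy; have h0 : secO 0 U (fun=> 0 : F) by apply: secO_cst.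
have := vfD h0 h0 Uy; rewrite (@vf_ext _ (fun=> 0)) //; last by move=> ? _; rewrite addr0.
  by move/eqP; rewrite -subr_eq0 opprD addrA subrr add0r oppr_eq0 => /eqP.
exact: secOD.
Qed.

Lemma vfZ c f y : secO 0 U f -> U y -> D (fun z => c * f z) y = c * D f y.
Proof.
move=> hf Uy; have h0 : secO 0 U (fun=> 0 : F) by apply: secO_cst.
case: (hDU hf h0) => _ _ /(_ c y Uy) h _; move: h.
rewrite vf0 // addr0 => <-; apply: vf_ext => //; first exact: secOZ.
by move=> z _; rewrite addr0.
Qed.

Lemma vf_cst c y : U y -> D (fun=> c) y = 0.
Proof.
move=> Uy; have h1 : secO 0 U (fun=> 1 : F) by apply: secO_cst.
have := vfM h1 h1 Uy; rewrite (@vf_ext _ (fun=> 1)) //; last first.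
- by move=> ? _; rewrite mulr1.
- exact: secOM0.
move/eqP; rewrite mul1r -subr_eq0 opprD addrA subrr add0r oppr_eq0 => /eqP d1.
rewrite -[RHS](mulr0 c) -d1 -vfZ //; apply: vf_ext => //; first exact: secO_cst.
by move=> z _; rewrite mulr1.
Qed.

Lemma vf_sum (I : Type) (l : seq I) (f : I -> pt -> F) y :
  (forall i, secO 0 U (f i)) -> U y ->
  D (fun z => \sum_(i <- l) f i z) y = \sum_(i <- l) D (f i) y.
Proof.
move=> hf Uy; elim: l => [|i l IH].
  rewrite big_nil -[RHS](vf0 Uy); apply: vf_ext => // [|z _]; last by rewrite big_nil.
  by apply: (secO_ext _ (secO_cst 0)) => z _; rewrite big_nil.
have hs : secO 0 U (fun z => \sum_(i <- l) f i z).
  elim: {IH} l => [|j l IH].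
    by apply: (secO_ext _ (secO_cst 0)) => z _; rewrite big_nil.
  by apply: (secO_ext _ (secOD (hf j) IH)) => z _; rewrite big_cons.
rewrite big_cons -IH -vfD //; apply: vf_ext => // [|z _]; last by rewrite big_cons.
by apply: (secO_ext _ (secOD (hf i) hs)) => z _; rewrite big_cons.
Qed.

Lemma iter_vf_secO n f : secO 0 U f -> secO 0 U (iter n D f).
Proof. by move=> hf; elim: n => //= n IH; apply: vf_secO. Qed.

Lemma iter_vf_ext n f g y : secO 0 U f -> (forall z, U z -> f z = g z) -> U y ->
  iter n D f y = iter n D g y.
Proof.
move=> hf fg; elim: n y => [|n IH] y Uy /=; first exact: fg.
by apply: vf_ext => //; apply: iter_vf_secO.
Qed.

Lemma iter_vfD n f g y : secO 0 U f -> secO 0 U g -> U y ->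
  iter n D (fun z => f z + g z) y = iter n D f y + iter n D g y.
Proof.
move=> hf hg; elim: n y => [|n IH] y Uy //=.
rewrite -vfD //; try exact: iter_vf_secO.
by apply: vf_ext => //; apply/iter_vf_secO/secOD.
Qed.

(* jets N y f P: modulo t^N, P is the expansion at y of f along the formal     *)
(* flow exp(t D).                                                              *)
Definition jets (N : nat) y f (P : {poly F}) : Prop :=
  secO 0 U f /\ forall n, (n < N)%N -> iter n D f y = n`!%:R * P`_n.

Variable y : pt.
Hypothesis Uy : U y.

Lemma jets_le M N f P : (M <= N)%N -> jets N y f P -> jets M y f P.
Proof. by move=> MN [hf h]; split=> // n nM; apply/h/(leq_trans nM). Qed.

Lemma jets_ext N f g P : (forall z, U z -> f z = g z) -> jets N y f P ->
  jets N y g P.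
Proof.
move=> fg [hf h]; split; first exact: secO_ext hf.
by move=> n nN; rewrite -h //; apply/esym/iter_vf_ext.
Qed.

Lemma jets_cst N c : jets N y (fun=> c) c%:P.
Proof.
split=> [|[|n] _]; first exact: secO_cst.
  by rewrite fact0 mul1r coefC.
rewrite coefC mulr0; have h0 : secO 0 U (fun=> 0 : F) by apply: secO_cst.
rewrite iterSr (@iter_vf_ext _ _ (fun=> 0)) //.
- by elim: n => //= n IH; rewrite -/(iter n.+1 D _ y) iterSr;
    rewrite (@iter_vf_ext _ _ (fun=> 0)) //; [apply: vf_secO|move=> z; apply: vf0].
- exact/vf_secO/secO_cst.
by move=> z; apply: vf_cst.
Qed.

Lemma jetsD N f g P Q : jets N y f P -> jets N y g Q ->
  jets N y (fun z => f z + g z) (P + Q).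
Proof.
move=> [hf h] [hg h']; split=> [|n nN]; first exact: secOD.
by rewrite iter_vfD // h // h' // coefD mulrDr.
Qed.

Lemma jets_deriv N f P : jets N.+1 y f P -> jets N y (D f) P^`().
Proof.
move=> [hf h]; split=> [|n nN]; first exact: vf_secO.
rewrite -iterSr h // coef_deriv factS natrM -mulr_natl; ring.
Qed.

(** The coefficients of order n+1 of a product are governed by those of order n of its derivative,
    and D and the formal derivative obey the same product rule; no binomial sum is needed. *)
Lemma jetsM N f g P Q : jets N y f P -> jets N y g Q ->
  jets N y (fun z => f z * g z) (P * Q).
Proof.
move=> hf hg; split=> [|n]; first exact: secOM0 hf.1 hg.1.
elim: n N f g P Q hf hg => [|n IH] N f g P Q hf hg nN.
  case: hf hg => [_ /(_ _ nN)] hf [_ /(_ _ nN)] hg.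
  by move: hf hg; rewrite fact0 !mul1r coef0M /= => -> ->.
case: N nN hf hg => // N nN hf hg.
rewrite iterSr (@iter_vf_ext _ _ (fun z => f z * D g z + g z * D f z)) //.
- rewrite iter_vfD //; [|exact/secOM0/vf_secO/hg.1/hf.1|exact/secOM0/vf_secO/hf.1/hg.1].
  rewrite (IH N _ _ P Q^`()) ?(IH N _ _ Q P^`()) //;
    try exact: jets_deriv; try exact: jets_le (leqnSn N) _.
  rewrite -mulrDr -coefD.
  have -> : P * Q^`() + Q * P^`() = (P * Q)^`() by rewrite derivM; ring.
  rewrite coef_deriv factS natrM -mulr_natl; ring.
- exact/vf_secO/secOM0/hg.1/hf.1.
by move=> z Uz; rewrite vfM //; [apply: hf.1|apply: hg.1].
Qed.

Lemma jets_sum N (I : Type) (l : seq I) (f : I -> pt -> F) P :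
  (forall i, jets N y (f i) (P i)) ->
  jets N y (fun z => \sum_(i <- l) f i z) (\sum_(i <- l) P i).
Proof.
move=> h; elim: l => [|i l IH].
  by rewrite big_nil; apply: jets_ext (jets_cst _ _) => z _; rewrite big_nil.
by rewrite big_cons; apply: jets_ext (jetsD (h i) IH) => z _; rewrite big_cons.
Qed.

Lemma jets_prod N (I : Type) (l : seq I) (f : I -> pt -> F) P :
  (forall i, jets N y (f i) (P i)) ->
  jets N y (fun z => \prod_(i <- l) f i z) (\prod_(i <- l) P i).
Proof.
move=> h; elim: l => [|i l IH].
  by rewrite big_nil; apply: jets_ext (jets_cst _ _) => z _; rewrite big_nil.
by rewrite big_cons; apply: jets_ext (jetsM (h i) IH) => z _; rewrite big_cons.
Qed.

Lemma jets_det N m (A : pt -> 'M[F]_m) (P : 'M[{poly F}]_m) :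
  (forall i j, jets N y (fun z => A z i j) (P i j)) ->
  jets N y (fun z => \det (A z)) (\det P).
Proof.
move=> h; apply: jets_sum => s.
apply: jetsM; last by apply: jets_prod => i.
have -> : (-1) ^+ s = ((-1) ^+ s)%:P :> {poly F} by rewrite rmorph_sign.
exact: jets_cst.
Qed.

Lemma jets_mulmxr N m n p (A : pt -> 'M[F]_(m, n)) (P : 'M[{poly F}]_(m, n))
    (C : 'M[F]_(n, p)) :
  (forall i j, jets N y (fun z => A z i j) (P i j)) ->
  forall i j, jets N y (fun z => (A z *m C) i j) ((P *m map_mx polyC C) i j).
Proof.
move=> h i j; rewrite mxE.
apply: (@jets_ext _ (fun z => \sum_k A z i k * C k j)).
  by move=> z _; rewrite mxE.
apply: jets_sum => k; rewrite mxE; apply: jetsM => //; exact: jets_cst.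
Qed.

Hypothesis char0 : forall n, n.+1%:R != 0 :> F.

Lemma fact_neq0 n : n`!%:R != 0 :> F.
Proof. by have := fact_gt0 n; case: (n`!) => // m _; apply: char0. Qed.

Lemma jets_poly N f : secO 0 U f ->
  jets N y f (\poly_(n < N) (iter n D f y / n`!%:R)).
Proof.
move=> hf; split=> // n nN.
by rewrite coef_poly nN mulrC divfK // fact_neq0.
Qed.

(** The factor t is made explicit, so that a product of m functions vanishing at [y] visibly has a
    jet divisible by t^m. *)
Lemma jets_poly0 N f : secO 0 U f -> f y = 0 ->
  jets N y f ('X * \poly_(n < N) (iter n.+1 D f y / n.+1`!%:R)).
Proof.
move=> hf f0; split=> // -[|n] nN; first by rewrite coefXM mulr0.
by rewrite coefXM coef_poly /= (ltnW nN) mulrC divfK // fact_neq0.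
Qed.

End Calculus.

End VectorFields.

(** * Taylor series along a flow *)

Section TaylorSeries.

Variables (F : closedFieldType) (r : nat).

Notation pt := 'rV[F]_r.+1.

Variables (X U : pt -> Prop) (D : (pt -> F) -> pt -> F).
Hypotheses (X0 : forall x, X x -> x != 0).
Hypotheses (oU : open_in X U) (hD : vector_field X U D).

Implicit Types (x y : pt) (W : pt -> pt -> Prop) (sg tau : pt -> pt -> F).

Lemma taylorE (s : pt -> 'cV[F]_r.+1) x y :
  taylor s x y = \sum_i y 0 i * s x i 0.
Proof. by rewrite /taylor mxE. Qed.

Section Flow.

Hypothesis char0 : forall n, n.+1%:R != 0 :> F.
Variable i0 : 'I_r.+1.
Hypothesis Ui0 : forall y, U y -> y 0 i0 != 0.

Lemma secO_ratio i : secO 0 U (fun y => y 0 i / y 0 i0).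
Proof.
by apply: (@secOM' _ _ 0 1 (-1)); [rewrite subrr|apply: secO_coord|apply: secO_coordV].
Qed.

(* In the direction of y, the Taylor section of s at x is the function         *)
(* y |-> (sum_i s_i(x) y_i) / y_i0, which the expression in I_Delta^m writes   *)
(* as a sum of products of m functions vanishing at x.                         *)
Lemma iter_vf_taylor m a W N (g : 'I_N -> 'I_m -> pt -> pt -> F)
    (tau : 'I_N -> pt -> pt -> F) (s : pt -> 'cV[F]_r.+1) x n :
  U x -> open_in2 X W -> W x x -> Ipow_expr a 1 W g tau (taylor s) ->
  (n <= m)%N ->
  \sum_i iter n D (fun y => y 0 i / y 0 i0) x * s x i 0 =
    if n == m then m`!%:R * \sum_j (\prod_(l < m) D (g j l x) x) *
      (tau j x x / x 0 i0) else 0.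
Proof.
move=> Ux oW Wx [hg ht E] nm.
pose U' y := U y /\ W x y.
have oU' : open_in X U' by apply: openI oU (open_snd X0 oW (open_sub oU Ux)).
have hD' : vector_field X U' D by apply: vector_field_sub hD => y [].
have U'x : U' x by [].
have hrat i : secO 0 U' (fun y => y 0 i / y 0 i0).
  by apply: secO_sub (secO_ratio i) => y [].
have hgO j l : secO 0 U' (g j l x).
  by apply: (@secO_sub _ _ _ (W x)) => [y []//|]; apply: secO_snd (hg j l).1.
have htO j : secO 0 U' (fun y => tau j x y / y 0 i0).
  apply: (@secOM' _ _ 0 1 (-1)); first by rewrite subrr.
    by apply: (@secO_sub _ _ _ (W x)) => [y []//|]; apply: secO_snd (ht j).
  by apply: secO_coordV => y [/Ui0].
pose q j l := \poly_(n < m.+1) (iter n.+1 D (g j l x) x / n.+1`!%:R).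
pose T j := \poly_(n < m.+1) (iter n D (fun y => tau j x y / y 0 i0) x / n`!%:R).
(* The same function gets two jets: here t^m times a polynomial, from the expression in the ideal,
   and in [hL] the one from the coordinates. Comparing coefficients up to order m gives the
   claim. *)
have hR : jets U' D m.+1 x (fun y => \sum_i y 0 i / y 0 i0 * s x i 0)
    (\sum_j (\prod_(l < m) ('X * q j l)) * T j).
  apply: (@jets_ext _ _ _ _ _ oU' hD' _ U'x _
      (fun y => \sum_j (\prod_(l < m) g j l x y) * (tau j x y / y 0 i0))).
    move=> y [Uy Wxy]; transitivity (taylor s x y / y 0 i0).
      by rewrite (E x y Wxy) mulr_suml; apply: eq_bigr => j _; rewrite mulrA.
    by rewrite taylorE mulr_suml; apply: eq_bigr => i _; rewrite mulrAC.
  apply: (jets_sum oU' hD' U'x) => j; apply: (jetsM oU' hD' U'x).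
    apply: (jets_prod oU' hD' U'x) => l.
    exact: (jets_poly0 D char0 m.+1 (hgO j l) ((hg j l).2 x Wx)).
  exact: (jets_poly D x char0 m.+1 (htO j)).
have hL := jets_sum oU' hD' U'x (index_enum _) (fun i => jetsM oU' hD' U'x
  (jets_poly D x char0 m.+1 (hrat i)) (jets_cst oU' hD' U'x m.+1 (s x i 0))).
have n1 : (n < m.+1)%N by [].
transitivity (iter n D (fun y => \sum_i y 0 i / y 0 i0 * s x i 0) x).
  rewrite hL.2 // coef_sum mulr_sumr; apply: eq_bigr => i _.
  by rewrite coefMC coef_poly n1 mulrA [_ * (_ / _)]mulrC divfK // fact_neq0.
rewrite hR.2 // coef_sum.
under eq_bigr => j _ do
  rewrite big_split /= prodr_const card_ord -mulrA coefXnM.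
case: eqP nm => [-> _|/eqP nm nm']; last first.
  have -> : (n < m)%N by rewrite ltn_neqAle nm.
  by rewrite big1 ?mulr0.
rewrite ltnn subnn; congr (_ * _); apply: eq_bigr => j _.
rewrite coef0M coef0_prod coef_poly /= fact0 divr1; congr (_ * _).
by apply: eq_bigr => l _; rewrite coef_poly /= divr1.
Qed.

End Flow.

(** * Differentiation in the first variable *)

Definition vf_fst sg x y : F := D (sg^~ y) x.

Lemma secO2_0 a b W : (forall x y, W x y -> X x /\ X y) ->
  secO2 a b W (fun _ _ => 0).
Proof.
move=> WX; apply: (@secO2_ext _ _ _ _ _ (fun _ _ => 0 * 0)).
  by move=> x y _; rewrite mulr0.
apply: (secO2M' (esym (addr0 a)) (esym (add0r b))).
  by apply: (secO2_fst (U := X)) => [x y /WX[]//|]; apply: secO0.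
by apply: (secO2_snd (U := X)) => [x y /WX[]//|]; apply: secO0.
Qed.

Section Fst.

Variable W : pt -> pt -> Prop.
Hypotheses (oW : open_in2 X W) (WU : forall x y, W x y -> U x).

Let WX x y (h : W x y) := open2_sub oW h.

Lemma vf_fst_field x y : W x y ->
  open_in X (W^~ y) /\ vector_field X (W^~ y) D.
Proof.
move=> Wxy; split; first by apply: open_fst X0 oW _; case: (WX Wxy).
by apply: vector_field_sub hD => z; apply: WU.
Qed.

End Fst.

(** D acts on functions of one variable only, so joint regularity of the derivative needs proof. For
    a sum of products p(x) q(y) it holds because q(y) is a constant for D. *)
Lemma vf_fst_bihomog (i0 : 'I_r.+1) d e (p : bipoly F r) W :
  bihomog d e p -> open_in2 X W -> (forall x y, W x y -> U x) ->
  (forall x y, W x y -> x 0 i0 != 0) ->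
  secO2 0 e%:Z W (vf_fst (fun x y => evb p x y / x 0 i0 ^+ d)).
Proof.
move=> hp oW WU Wi0.
pose U' x := U x /\ (X x /\ evp 'X_i0 x <> 0).
have oU' : open_in X U' by apply: openI oU (open_ne X0 (dhomog_coord F i0)).
have hD' : vector_field X U' D by apply: vector_field_sub hD => y [].
have U'i0 x : U' x -> x 0 i0 != 0 by case=> _ [_]; rewrite evpX => /eqP.
have WU' x y : W x y -> U' x.
  move=> Wxy; split; first exact: WU Wxy.
  by split; [case: (open2_sub oW Wxy)|rewrite evpX; apply/eqP/(Wi0 _ _ Wxy)].
have hO q : q \is d.-homog -> secO 0 U' (fun x => evp q x / x 0 i0 ^+ d).
  move=> hq; apply: (@secO_ext _ _ _ _ (fun x => evp q x / evp ('X_i0 ^+ d) x)).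
    by move=> x _; rewrite evp_exp evpX.
  apply: (@secO_frac _ _ _ _ d d) => //; first exact: dhomog_coordX.
    by rewrite addr0.
  by move=> x /U'i0 ?; rewrite evp_exp evpX; apply/eqP; rewrite expf_neq0.
elim: p hp => [_|u p IH hp].
  apply: secO2_ext (@secO2_0 0 e W (fun x y => open2_sub oW)) => x y Wxy.
  rewrite /vf_fst -[LHS](vf0 oU' hD' (WU' _ _ Wxy)).
  apply: (vf_ext oU' hD') => //; [exact: secO_cst|move=> z _|exact: WU' Wxy].
  by rewrite /evb big_nil mul0r.
have hp' : bihomog d e p by move=> v vp; apply: hp; rewrite inE vp orbT.
have [hu1 hu2] := hp u (mem_head _ _).
have hpO y : secO 0 U' (fun x => evb p x y / x 0 i0 ^+ d).
  have := hO _ (dhomog_fst y hp'); apply: secO_ext => x _.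
  by rewrite evb_fst.
have h1 : secO2 0 e W (fun x y => D (fun x => evp u.1 x / x 0 i0 ^+ d) x * evp u.2 y).
  apply: (secO2M' (esym (addr0 0)) (esym (add0r e%:Z))).
    apply: (secO2_fst WU'); apply: (vf_secO oU' hD'); exact: hO.
  apply: (secO2_snd (U := X)) => [x y h|]; first by case: (open2_sub oW h).
  apply: (@secO_ext _ _ _ _ (fun y => evp u.2 y / evp 1 y)).
    by move=> y _; rewrite evp1 divr1.
  apply: (@secO_frac _ _ _ _ e 0) => //; rewrite ?dhomog1 ?add0r //.
  by move=> y _; rewrite evp1; apply/eqP; rewrite oner_eq0.
apply: secO2_ext (secO2D h1 (IH hp')) => x y Wxy.
have U'x := WU' _ _ Wxy.
rewrite /vf_fst mulrC -(vfZ oU' hD') //; last exact: hO.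
rewrite -(vfD oU' hD') //; last by apply/secOZ/hO.
apply: (vf_ext oU' hD') => //; first by apply: secOD => //; apply/secOZ/hO.
by move=> z _; rewrite /evb big_cons; ring.
Qed.

(** Quotient rule. Numerator and denominator have equal degree in the first variable; divided by a
    power of x_i0 they become P and Q of degree 0 there, and P = sg Q gives D sg = (D P - sg D Q) /
    Q. *)
Lemma vf_fst_secO2 b W sg : open_in2 X W -> (forall x y, W x y -> U x) ->
  secO2 0 b W sg -> secO2 0 b W (vf_fst sg).
Proof.
move=> oW WU hs; apply: (@secO2_local _ _ X) => [x y h|x y Wxy].
  exact: open2_sub h.
have [d1 [d2 [e1 [e2 [p [q [hp hq [hd hd'] hqx E]]]]]]] := hs x y Wxy.
have de : d1 = e1 by lia.
subst e1.
have /rV0Pn[i0 xi0] := X0 (open2_sub oW Wxy).1.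
pose W1 x y := [/\ X x, X y & evb q x y <> 0].
pose W2 x y := [/\ X x, X y & evb [:: ('X_i0, 1)] x y <> 0].
pose W0 x y := W x y /\ (W1 x y /\ W2 x y).
have oW12 : open_in2 X (fun x y => W1 x y /\ W2 x y).
  apply: open2I (open2_ne X hq) (open2_ne X _).
  exact: bihomog1 (dhomog_coord F i0) (dhomog1 _ _).
have oW0 : open_in2 X W0 by apply: open2I.
have [Xx Xy] := open2_sub oW Wxy.
exists (fun x y => W1 x y /\ W2 x y); split=> //.
  by split; split=> //; rewrite evb1 evpX evp1 mulr1; apply/eqP.
have W0i0 z w : W0 z w -> z 0 i0 != 0.
  by case=> _ [_ []]; rewrite evb1 evpX evp1 mulr1 => _ _ /eqP.
have W0q z w : W0 z w -> evb q z w != 0 by case=> _ [[_ _ /eqP]].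
have W0U z w : W0 z w -> U z by case=> /WU.
have W0W z w : W0 z w -> W z w by case.
rewrite -/W0; pose P z w := evb p z w / z 0 i0 ^+ d1.
pose Q z w := evb q z w / z 0 i0 ^+ d1.
have hs0 : secO2 0 b W0 sg by apply: secO2_sub hs.
have hP : secO2 0 d2 W0 (vf_fst P) by apply: vf_fst_bihomog.
have hQ : secO2 0 e2 W0 (vf_fst Q) by apply: vf_fst_bihomog.
have hQV : secO2 0 (- e2%:Z) W0 (fun z w => z 0 i0 ^+ d1 / evb q z w).
  apply: (@secO2_ext _ _ _ _ _ (fun z w => evb [:: ('X_i0 ^+ d1, 1)] z w / evb q z w)).
    by move=> z w _; rewrite evb1 evp_exp evpX evp1 mulr1.
  apply: (@secO2_frac _ _ _ _ _ d1 0 d1 e2) => //; try lia.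
    by apply: bihomog1; rewrite ?dhomog1 ?dhomog_coordX.
  by move=> z w /W0q/eqP.
have hN : secO2 0 d2 W0 (fun z w => vf_fst P z w + (-1) * (sg z w * vf_fst Q z w)).
  apply: secO2D => //; apply: secO2Z.
  by apply: (secO2M' (esym (addr0 0)) _ hs0 hQ); rewrite addrC.
have := secO2M' (esym (addr0 0)) (_ : b = d2%:Z + (- e2%:Z)) hN hQV.
move=> /(_ ltac:(lia)); apply: secO2_ext => z w W0zw.
have [oV hV] := vf_fst_field oW0 W0U W0zw.
have sgO : secO 0 (W0^~ w) (sg^~ w) by apply: secO_fst hs0.
have ratO e (l : bipoly F r) : bihomog d1 e l ->
    secO 0 (W0^~ w) (fun z' => evb l z' w / z' 0 i0 ^+ d1).
  move=> hl; apply: (@secO_ext _ _ _ _ (fun z' =>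
    evp (\sum_(u <- l) evp u.2 w *: u.1) z' / evp ('X_i0 ^+ d1) z')).
    by move=> z' _; rewrite -evb_fst evp_exp evpX.
  apply: (@secO_frac _ _ _ _ d1 d1); rewrite ?addr0 ?dhomog_coordX //.
    exact: dhomog_fst hl.
  by move=> z' /W0i0 ?; rewrite evp_exp evpX; apply/eqP; rewrite expf_neq0.
have -> : vf_fst P z w = sg z w * vf_fst Q z w + Q z w * vf_fst sg z w.
  rewrite -(vfM oV hV sgO (ratO _ _ hq) W0zw).
  apply: (vf_ext oV hV (ratO _ _ hp)) => // z' W0z'.
  have qz : evb q z' w != 0 := W0q z' w W0z'.
  by rewrite /Q (E z' w (W0W _ _ W0z')) ?mulrA ?divfK //; apply/eqP.
rewrite mulN1r addrC addKr /Q; field.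
by rewrite (W0q _ _ W0zw) expf_neq0 // (W0i0 _ _ W0zw).
Qed.

(** By the product rule D(g sg) = g D sg + sg D g, a derivation destroys at most one factor from the
    ideal. *)
Lemma vf_fst_Ipow m b W sg : open_in2 X W -> (forall x y, W x y -> U x) ->
  Ipow_on m.+1 0 b W sg -> Ipow_on m 0 b W (vf_fst sg).
Proof.
move=> oW WU hs.
pose Q n tau := [/\ secO2 0 b W tau, Ipow_on n 0 b W tau
  & Ipow_on n.-1 0 b W (vf_fst tau)].
have fstO c tau y : secO2 0 c W tau -> secO 0 (W^~ y) (tau^~ y).
  exact: secO_fst.
suff: Q m.+1 sg by case.
apply: Ipow_on_ind hs => {m sg}.
- move=> m sg tau st [h1 h2 h3]; split; try exact: (Ipow_on_ext st).
    exact: (secO2_ext st).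
  apply: Ipow_on_ext h3 => x y Wxy; have [oV hV] := vf_fst_field oW WU Wxy.
  apply: (vf_ext oV hV) => [|z Wz|//]; first exact: fstO h1.
  exact: st.
- move=> sg hs; split=> //; apply: Ipow_on0 => //.
  exact: vf_fst_secO2.
- move=> m; split; try exact: Ipow_on_nil.
    by apply: secO2_0 => x y /(open2_sub oW).
  apply: Ipow_on_ext (@Ipow_on_nil _ _ _ _ _ _) => x y Wxy.
  by have [oV hV] := vf_fst_field oW WU Wxy; rewrite /vf_fst (vf0 oV hV).
- move=> m sg tau [h1 h2 h3] [h1' h2' h3']; split.
  + exact: secO2D.
  + exact: Ipow_onD.
  apply: Ipow_on_ext (Ipow_onD h3 h3') => x y Wxy.
  have [oV hV] := vf_fst_field oW WU Wxy.
  by rewrite /vf_fst (vfD oV hV) //; [apply: fstO h1|apply: fstO h1'].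
move=> m g sg hg [h1 h2 h3]; split.
- by have := secO2M hg.1 h1; rewrite !add0r.
- exact: Ipow_onS.
have h4 : Ipow_on m 0 b W (fun x y => g x y * vf_fst sg x y).
  case: m h2 h3 => [|m] h2 h3; last exact: Ipow_onS.
  apply: Ipow_on0; have := secO2M hg.1 (vf_fst_secO2 oW WU h1).
  by rewrite !add0r.
have h5 := Ipow_onM (vf_fst_secO2 oW WU hg.1) h2; rewrite !add0r in h5.
apply: Ipow_on_ext (Ipow_onD h4 h5) => x y Wxy.
have [oV hV] := vf_fst_field oW WU Wxy.
rewrite /vf_fst (vfM oV hV) //; last exact: fstO h1.
  by rewrite [sg x y * _]mulrC.
exact: fstO hg.1.
Qed.

(** The Taylor section is linear in [s], so differentiating [s] amounts to differentiating its
    Taylor section in the first variable, which costs one power of the ideal of the diagonal. *)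
Lemma ker_taylor_derive k (s : pt -> 'cV[F]_r.+1) :
  ker_taylor X k.+1 0 U s ->
  ker_taylor X k 0 U (fun x => \col_i D (fun y => s y i 0) x).
Proof.
move=> [hs hI]; split=> [i|x Ux].
  by apply: (secO_ext _ (vf_secO oU hD (hs i))) => x _; rewrite mxE.
have [W [oW Wx h]] := hI x Ux.
pose W' y z := W y z /\ (U y /\ U z).
have oW' : open_in2 X W' by apply: open2I => //; apply: open2_prod.
exists W'; split=> //.
have h' : Ipow_on k.+2 0 1 W' (taylor s) by apply: Ipow_on_sub h => y z [].
have W'U y z : W' y z -> U y by case=> _ [].
apply: Ipow_on_ext (vf_fst_Ipow oW' W'U h') => y z W'yz.
have Uy := W'U _ _ W'yz.
rewrite /vf_fst taylorE.
transitivity (D (fun x => \sum_i z 0 i * s x i 0) y).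
  apply: (vf_ext (vf_fst_field oW' W'U W'yz).1 (vf_fst_field oW' W'U W'yz).2) => //.
    apply: (secO_ext (f := fun x => \sum_i z 0 i * s x i 0)) => [w _|].
      by rewrite taylorE.
    by apply: secO_sum => [w [_ [/(open_sub oU)/X0//]]|i];
      apply: secOZ; apply: secO_sub (hs i) => w [_ []].
  by move=> w _; rewrite taylorE.
rewrite (vf_sum oU hD) //; last by move=> i; apply: secOZ; apply: hs.
by apply: eq_bigr => i _; rewrite (vfZ oU hD) ?mxE //; apply: hs.
Qed.

End TaylorSeries.
(** * The trapezoid rule *)

Section LinearAlgebra.

(** Multiplication by [cokermx A] is the passage to the quotient by the row space of [A]. *)
Lemma mxrank_col_mx_coker (F : fieldType) m1 m2 n (A : 'M[F]_(m1, n))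
    (B : 'M[F]_(m2, n)) :
  \rank (col_mx A B) = (\rank A + \rank (B *m cokermx A))%N.
Proof.
have kerA : (kermx (cokermx A) :=: A)%MS.
  apply/eqmxP/andP; split; last by rewrite sub_kermx mulmx_coker.
  by rewrite submxE mulmx_ker.
have E1 := mxrank_mul_ker B (cokermx A).
have E2 := mxrank_sum_cap A B.
rewrite -addsmxE.
have E3 : \rank (B :&: kermx (cokermx A)) = \rank (A :&: B).
  by rewrite (cap_eqmx (eqmx_refl B) kerA) capmxC.
lia.
Qed.

Lemma row_col_mx_neq (T : Type) m n (A : 'M[T]_(m, n)) (v w : 'rV[T]_n)
    (i : 'I_(m + 1)) :
  i != rshift m 0 -> row i (col_mx A v) = row i (col_mx A w).
Proof.
case: (split_ordP i) => j -> ; first by rewrite !rowKu.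
by rewrite ord1 eqxx.
Qed.

Lemma det_last_rowD (R : comNzRingType) m n (A : 'M[R]_(m, n)) (v w : 'rV[R]_n)
    (b c : R) (C : 'M[R]_(n, m + 1)) :
  \det (col_mx A (b *: v + c *: w) *m C) =
    b * \det (col_mx A v *m C) + c * \det (col_mx A w *m C).
Proof.
have row'E (v1 w1 : 'rV[R]_n) : row' (rshift m 0) (col_mx A v1 *m C) =
    row' (rshift m 0) (col_mx A w1 *m C).
  apply/row_matrixP => i; rewrite !row_rowsub !row_mul.
  by rewrite (@row_col_mx_neq _ _ _ _ v1 w1) // eq_sym neq_lift.
apply: (determinant_multilinear (i0 := rshift m 0)) => //.
by rewrite !row_mul !rowKd !row_id mulmxDl -!scalemxAl.
Qed.

Lemma det_sub_eq0 (F : fieldType) m n (A : 'M[F]_(m, n)) p (B : 'M[F]_(p, n))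
    (C : 'M[F]_(n, m)) :
  (A <= B)%MS -> (\rank B < m)%N -> \det (A *m C) = 0.
Proof.
move=> AB rB; apply/eqP; apply: contraLR rB => dn0.
have /mxrank_unit rAC : A *m C \in unitmx by rewrite unitmxE unitfE.
by rewrite -leqNgt -[leqLHS]rAC (leq_trans (mxrankM_maxl _ _)) ?mxrankS.
Qed.

End LinearAlgebra.

Section Trapezoid.

Variables (F : closedFieldType) (r : nat).
Hypothesis char0 : forall n, n.+1%:R != 0 :> F.

Notation pt := 'rV[F]_r.+1.

Variables (X U V : pt -> Prop) (D : (pt -> F) -> pt -> F).
Hypotheses (irr : irreducible X) (X0 : forall x, X x -> x != 0).
Hypotheses (oU : open_in X U) (hD : vector_field X U D).
Hypotheses (oV : open_in X V) (neV : exists y, V y).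

Variables (m rho : nat) (B : pt -> 'M[F]_(m, r.+1)) (b : 'I_r.+1 -> pt -> F).
Variable x : pt.

(** The n-th derivative at time 0 of the curve that [b] traces along the flow of D from [y]. *)
Let flow n y : 'rV[F]_r.+1 := \row_i iter n D (b i) y.
Let B1 : 'M[F]_(m, r.+1) := \matrix_(i, j) D (fun y => B y i j) x.

Hypotheses (Ux : U x) (BO : forall i j, secO 0 U (fun y => B y i j)).
Hypotheses (bO : forall i, secO 0 U (b i)).
Hypotheses (free : row_free (B x)).
Hypotheses (rank_le : forall y, U y -> V y ->
  (\rank (col_mx (B x) (B y)) <= rho)%N).
Hypotheses (rank_ge : (rho <= \rank (col_mx (B x) B1))%N).
Hypotheses (b0 : forall y, U y -> (flow 0 y <= B y)%MS).
Hypotheses (b1 : forall y, U y -> (flow 1 y <= B y)%MS).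

(** The decisive minor has order of vanishing p + 3: one power of t from each of p rows and t^3 from
    the trapezoid row. Jets modulo t^(p+4) just reach its leading coefficient. *)
Let N p := p.+4.
Let jet N f : {poly F} := \poly_(n < N) (iter n D f x / n`!%:R).

(** All rows lie in the sum of the spaces at [x] and at [y], of rank at most [rho] for [y] in [V],
    so the minor of size m + p + 1 vanishes there. The identity principle extends this to all of
    [U], including [x] itself, where the jet is taken. *)
Lemma det_flow_eq0 p (Q : 'M[F]_(p, m)) (C : 'M[F]_(r.+1, m + p + 1)) j k :
  (rho <= m + p)%N -> (j <= 1)%N -> (k < N p)%N ->
  (\det (col_mx (col_mx (map_mx polyC (B x))
      (map_mx polyC Q *m \matrix_(i, l) jet (N p) (fun y => B y i l)))
      (\row_i jet (N p) (iter j D (b i))) *m map_mx polyC C))`_k = 0.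
Proof.
move=> rho_le j1 kN.
pose G y := col_mx (col_mx (B x) (Q *m B y)) (flow j y).
have hbO i : secO 0 U (iter j D (b i)) by apply: (iter_vf_secO oU hD).
set P := col_mx _ _.
have hj : jets U D (N p) x (fun y => \det (G y *m C)) (\det (P *m map_mx polyC C)).
  apply: (jets_det oU hD Ux); apply: (jets_mulmxr oU hD Ux) => i l.
  rewrite /G /P; case: (split_ordP i) => {}i ->; last first.
    rewrite col_mxEd mxE; apply: (jets_ext oU hD Ux _ (jets_poly D x char0 (N p) (hbO l))).
    by move=> z _; rewrite col_mxEd mxE.
  rewrite col_mxEu; case: (split_ordP i) => {}i ->.
    rewrite col_mxEu mxE; apply: (jets_ext oU hD Ux _ (jets_cst oU hD Ux _ _)).
    by move=> z _; rewrite !col_mxEu.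
  rewrite col_mxEd mxE.
  apply: (@jets_ext _ _ _ _ _ oU hD _ Ux _ (fun z => \sum_a Q i a * B z a l)).
    by move=> z _; rewrite col_mxEu col_mxEd mxE.
  apply: (jets_sum oU hD Ux) => a; rewrite !mxE; apply: (jetsM oU hD Ux).
    exact: (jets_cst oU hD Ux).
  exact: jets_poly.
have det0 y : U y -> \det (G y *m C) = 0.
  apply: (secO_eq0 irr X0 oU oV neV hj.1) => {}y Uy Vy.
  apply: (det_sub_eq0 (B := col_mx (B x) (B y))).
    rewrite -!addsmxE addsmx_sub -addsmxE addsmx_sub addsmxSl /=.
    apply/andP; split.
      exact: submx_trans (submxMl _ _) (addsmxSr _ _).
    apply: submx_trans (addsmxSr _ _).
    by case: (j) j1 => [|[|]] // _; [apply: b0|apply: b1].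
  rewrite addn1 ltnS; exact: leq_trans (rank_le Uy Vy) rho_le.
have := jets_ext oU hD Ux det0 hj.
move=> [_ /(_ k kN)]; case: (jets_cst oU hD Ux (N p) 0) => _ /(_ k kN) ->.
rewrite coef0 mulr0 => /esym/eqP; rewrite mulf_eq0 (negbTE (fact_neq0 char0 k)).
by move/eqP.
Qed.

(* The trapezoid rule: (f(t) - f(0)) - t (f'(t) + f'(0)) / 2 starts with       *)
(* -t^3 f'''(0) / 12.                                                          *)
Lemma trapezoid_rule : (flow 3 x <= col_mx (B x) B1)%MS.
Proof.
apply: contrapT => /negP nsub.
(* The coefficient of t^3 is 1/3! from b(t) minus (1/2)(1/2!) from t b'(t) / 2. *)
pose c : F := 6%:R^-1 - 4%:R^-1.
have c0 : c != 0.
  have -> : c = - 12%:R^-1.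
    by rewrite /c; field; rewrite !(char0 3, char0 5, char0 11).
  by rewrite oppr_eq0 invr_eq0 char0.
(* [Q] selects p combinations of the derivative rows that complete [B x] to a basis [A] of the row
   space of [col_mx (B x) B1]. *)
pose K := B1 *m cokermx (B x); pose p := \rank K.
have [Q hQ] : exists Q : 'M_(p, m), row_base K = Q *m K.
  by apply/submxP; rewrite eq_row_base.
pose A := col_mx (B x) (Q *m B1).
have rB : \rank (B x) = m by apply/eqP.
have rA : \rank A = (m + p)%N.
  by rewrite mxrank_col_mx_coker rB -mulmxA -/K -hQ eq_row_base.
have rE : \rank (col_mx (B x) B1) = (m + p)%N by rewrite mxrank_col_mx_coker rB.
have AE : (A <= col_mx (B x) B1)%MS.
  rewrite -!addsmxE addsmx_sub addsmxSl /=.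
  exact: submx_trans (submxMl _ _) (addsmxSr _ _).
(* If b'''(0) were outside, these m + p + 1 rows would be independent. Their right inverse [C]
   singles out a minor equal to 1, to be contradicted. *)
have /row_freeP[C hC] : row_free (col_mx A (c *: flow 3 x)).
  rewrite /row_free mxrank_col_mx_coker rA eqn_add2l rank_rV.
  suff -> : c *: flow 3 x *m cokermx A != 0 by [].
  rewrite -submxE; apply: contra nsub => h.
  apply: submx_trans AE; rewrite -[flow 3 x](scalerK c0).
  exact: scalemx_sub.
have rho_le : (rho <= m + p)%N by rewrite -rE.
pose cst m n (M : 'M[F]_(m, n)) : 'M[{poly F}]_(m, n) := map_mx polyC M.
pose PB : 'M[{poly F}]_(m, r.+1) := \matrix_(i, l) jet (N p) (fun y => B y i l).
pose Pb j : 'rV[{poly F}]_r.+1 := \row_i jet (N p) (iter j D (b i)).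
pose M := col_mx (cst _ _ (B x)) (cst _ _ Q *m PB).
pose L v := \det (col_mx M v *m cst _ _ C).
have L0 j k : (j <= 1)%N -> (k < N p)%N -> (L (Pb j))`_k = 0.
  exact: det_flow_eq0.
(* The constant vectors b(0) and b'(0) of the trapezoid rule lie in the span of the first m rows and
   do not contribute to the minor. *)
have Lc v : (v <= B x)%MS -> L (cst _ _ v) = 0.
  move=> /submxP[u ->]; rewrite /L.
  have -> : col_mx M (cst _ _ (u *m B x)) =
      block_mx 1%:M 0 (row_mx (cst _ _ u) 0) (0 : 'M_1) *m col_mx M 0.
    rewrite mul_block_col mul1mx mul0mx addr0 mulmx0 addr0 mul_row_col mul0mx.
    by rewrite addr0 /cst map_mxM.
  by rewrite -mulmxA det_mulmx det_lblock det0 mulr0 mul0r.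
pose h : {poly F} := - ((2%:R^-1)%:P * 'X).
pose wt := 1 *: (1 *: Pb 0%N + (-1) *: cst _ _ (flow 0 x)) +
  h *: (1 *: Pb 1%N + 1 *: cst _ _ (flow 1 x)).
have Lwt k : (k < N p)%N -> (L wt)`_k = 0.
  move=> kN; rewrite /L !det_last_rowD -/(L _) -/(L _) -/(L _) -/(L _).
  rewrite !Lc ?b0 ?b1 // !mulr0 !addr0 !mul1r coefD L0 // add0r.
  rewrite mulNr coefN -mulrA coefCM coefXM.
  by case: k kN => [|k] kN /=; rewrite ?L0 ?mulr0 ?oppr0 // ltnW.
have wtE i k : (wt 0 i)`_k = (jet (N p) (b i))`_k - (iter 0 D (b i) x)%:P`_k -
    2%:R^-1 * (if k is k'.+1 then (jet (N p) (D (b i)))`_k' +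
       (D (b i) x)%:P`_k' else 0).
  rewrite !mxE !mul1r mulN1r coefD coefB; congr (_ + _).
  by rewrite mulNr coefN -mulrA coefCM coefXM; case: k => //= k; rewrite coefD.
have jetE n f : (n < N p)%N -> (jet (N p) f)`_n = iter n D f x / n`!%:R.
  by move=> nN; rewrite coef_poly nN.
pose w' : 'rV[{poly F}]_r.+1 := \row_i drop_poly 3 (wt 0 i).
have two : 2%:R != 0 :> F := char0 1.
(* The trapezoid rule is exact to second order: the coefficients of order 0, 1 and 2 cancel. *)
have wtX : wt = 'X^3 *: w'.
  apply/rowP => i; rewrite [RHS]mxE [w' 0 i]mxE mulrC.
  apply/polyP => k; rewrite coefMXn coef_drop_poly; case: ltnP => k3; last first.
    by rewrite subnK.
  rewrite wtE !coefC; case: k k3 => [|[|[|]]] //= _; rewrite !jetE //=.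
  - by rewrite divr1 subrr mulr0 subr0.
  - by rewrite !divr1 subr0 coefC -mulr2n -[X in _ * X]mulr_natl mulKf ?subrr.
  by rewrite !divr1 coefC addr0 subr0 mulrC subrr.
pose PB' : 'M[{poly F}]_(m, r.+1) := \matrix_(i, l) drop_poly 1 (PB i l).
have PBE : PB = cst _ _ (B x) + 'X *: PB'.
  apply/matrixP => i l; apply/polyP => k; rewrite ![in RHS]mxE coefD coefC coefXM.
  rewrite [PB _ _]mxE; case: k => [|k] /=; first by rewrite jetE // divr1 addr0.
  by rewrite coef_drop_poly addn1 add0r.
pose G := col_mx (col_mx (cst _ _ (B x)) (cst _ _ Q *m PB')) w'.
(* Modulo the first m rows the middle ones are t Q B'(t); a block triangular factor takes out t from
   these p rows and t^3 from the last one. *)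
have LG : L wt = 'X^(p + 3) * \det (G *m cst _ _ C).
  rewrite /L; have -> : col_mx M wt = block_mx (block_mx 1%:M 0 (cst _ _ Q) 'X%:M)
      0 0 ('X^3)%:M *m G.
    rewrite mul_block_col mul_block_col !mul0mx mul1mx !addr0 add0r.
    rewrite !mul_scalar_mx -wtX /M PBE mulmxDr; congr col_mx; congr col_mx.
    by rewrite scalemxAr.
  by rewrite -mulmxA det_mulmx !det_lblock det1 !det_scalar mul1r expr1 -exprD.
(* The value at 0 is the coefficient of order p + 3 of [L wt], just below the precision p + 4. The
   rows of [G] at 0 are those of [A] and c b'''(0), so this value is also the minor equal to 1. *)
have G0 : (\det (G *m cst _ _ C)).[0] = 0.
  have := Lwt (p + 3)%N; rewrite LG coefXnM ltnn subnn horner_coef0; apply.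
  by rewrite /N addnS addn2.
have := oner_eq0 F; rewrite -G0 -[X in X == _](det1 F (m + p + 1)) -hC.
have -> : (\det (G *m cst _ _ C)).[0] = \det (map_mx (horner_eval 0) (G *m cst _ _ C)).
  by rewrite det_map_mx.
suff -> : map_mx (horner_eval 0) (G *m cst _ _ C) = col_mx A (c *: flow 3 x) *m C.
  by rewrite eqxx.
have hc n1 n2 (Y : 'M_(n1, n2)) : map_mx (horner_eval 0) (cst _ _ Y) = Y.
  by apply/matrixP => i l; rewrite !mxE horner_evalE hornerC.
rewrite map_mxM /= hc !map_col_mx map_mxM /= !hc; congr (col_mx (col_mx _ (_ *m _)) _ *m _).
  apply/matrixP => i l; rewrite !mxE horner_evalE horner_coef0 coef_drop_poly.
  by rewrite jetE // divr1.
apply/rowP => i; rewrite mxE horner_evalE horner_coef0 [w' 0 i]mxE coef_drop_poly.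
rewrite wtE !coefC [RHS]mxE [flow 3 x 0 i]mxE !jetE //=.
rewrite coefC subr0 addr0 mulrBl; congr (_ - _); first by rewrite mulrC.
by rewrite jetE //= mulrCA -invfM -natrM mulrC.
Qed.

End Trapezoid.

(** * Polarization *)

Section Polarization.

Variable F : closedFieldType.

Local Notation widen := (widen_ord (leqnSn _)).

Lemma poly_fun_eq0 (p : {poly F}) : (forall t, p.[t] = 0) -> p = 0.
Proof.
move=> h; apply/eqP; apply: contraT => /closed_nonrootP[t].
by rewrite /root h eqxx.
Qed.

(** [muni] reads p as a polynomial in its last variable; each coefficient of p is recovered from the
    exponent of that variable and the remaining exponents. *)
Lemma muni_eq0 n (p : {mpoly F[n.+1]}) : muni p = 0 -> p = 0.
Proof.
move=> h; apply/mpolyP => m; rewrite mcoeff0.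
have [m_in|] := boolP (m \in msupp p); last exact: memN_msupp_eq0.
have := congr1 (fun q : {poly {mpoly F[n]}} =>
  (q`_(m ord_max))@_[multinom m (widen i) | i < n]) h.
rewrite coef0 mcoeff0 muniE coef_sum raddf_sum /= => <-.
rewrite (bigD1_seq m) //= coefZ coefXn eqxx mulr1 mcoeffZ mcoeffX eqxx mulr1.
rewrite big1 ?addr0 // => m' /eqP m'm.
rewrite coefZ coefXn; case: (eqVneq (m ord_max) (m' ord_max)) => [mm|]; last first.
  by rewrite mulr0 mcoeff0.
rewrite mulr1 mcoeffZ mcoeffX; case: eqP => [mw|]; last by rewrite mulr0.
case: m'm; apply/mnmP => i; case: (unliftP ord_max i) => [j|] ->; last by rewrite mm.
have -> : lift ord_max j = widen j by apply: val_inj; rewrite /= /bump leqNgt ltn_ord.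
by have /mnmP/(_ j) := mw; rewrite !mnmE.
Qed.

(** Induction on the number of variables. In one variable, a nonzero polynomial over an
    algebraically closed field has a nonroot. *)
Lemma mpoly_fun_eq0 n (p : {mpoly F[n]}) : (forall c, p.@[c] = 0) -> p = 0.
Proof.
elim: n p => [|n IH] p h.
  have := h (fun=> 0); rewrite (nvar0_mpolyC p) mevalC => ->.
  by rewrite mpolyC0.
apply: muni_eq0; apply/polyP => d; rewrite coef0; apply: IH => v.
have E : map_poly (meval v) (muni p) = 0.
  apply: poly_fun_eq0 => t.
  pose c i := if unlift ord_max i is Some j then v j else t.
  rewrite -[RHS](h c) mevalE muniE raddf_sum /= horner_sum.
  apply: eq_bigr => m _.
  rewrite map_polyZ /= map_polyXn hornerZ hornerXn mevalZ mevalX -mulrA.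
  rewrite big_ord_recr /= /c unlift_none; congr (_ * (_ * _)).
  apply: eq_bigr => i _; rewrite mnmE.
  have -> : widen i = lift ord_max i.
    by apply: val_inj; rewrite /= /bump leqNgt ltn_ord.
  by rewrite liftK.
by rewrite -coef_map E coef0.
Qed.

(* Inclusion-exclusion: the terms indexed by a non-surjective f cancel out.    *)
Lemma permanent_ryser (R : comNzRingType) k (v : 'M[R]_k) :
  \sum_(s : 'S_k) \prod_i v i (s i) =
  \sum_(S : {set 'I_k}) (\prod_i (if i \in S then 1 else -1)) *
    \prod_l \sum_(i in S) v i l.
Proof.
(* Passing to inverse permutations makes [f] send columns to rows, as in the expansion of a product
   over l of sums over i. *)
transitivity (\sum_(f : {ffun 'I_k -> 'I_k} | injectiveb f) \prod_l v (f l) l).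
  rewrite (reindex (@pval _)) /=; last first.
    pose in_Sn := insubd (1%g : 'S_k).
    by exists in_Sn => /= f Uf; first apply: val_inj; apply: insubdK.
  rewrite (reindex_inj invg_inj); apply: eq_big => /= [s|s _].
    by rewrite (valP s).
  rewrite (reindex_perm s); apply: eq_bigr => i _.
  by rewrite permK pvalE.
have inj (f : {ffun 'I_k -> 'I_k}) :
    injectiveb f = [forall i, i \in codom f] :> bool.
  apply/injectiveP/forallP => [fi i|fs].
    exact: (inj_card_onto fi (leqnn _)).
  apply/injectiveP; apply: (leq_size_uniq (enum_uniq 'I_k)) => [i _|].
    exact: fs.
  by rewrite size_map.
under [RHS]eq_bigr => S _ do rewrite bigA_distr_big mulr_sumr.
transitivity (\sum_(f : {ffun 'I_k -> 'I_k})
    \sum_(S : {set 'I_k} | f \in ffun_on (mem S))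
    (\prod_i (if i \in S then 1 else -1)) * \prod_l v (f l) l); last first.
  by rewrite [RHS](exchange_big_dep predT).
rewrite big_mkcond; apply: eq_bigr => f _; rewrite -mulr_suml.
suff -> : \sum_(S : {set 'I_k} | f \in ffun_on (mem S))
    \prod_i (if i \in S then 1 else -1) = (injectiveb f)%:R :> R.
  by case: ifP; rewrite ?mul1r ?mul0r.
(* The signed count of the sets S containing the image of f factors over i: a point of the image
   gives 1, any other point 1 - 1. *)
transitivity (\prod_i (1 + - (i \notin codom f)%:R : R)).
  rewrite bigA_distr big_mkcond; apply: eq_bigr => S _.
  case: ifP => [/ffun_onP fS|/negbT nS].
    apply: eq_bigr => i _; case: ifP => // /negbT iS.
    have -> // : i \notin codom f.
    by apply: contra iS => /codomP[j ->]; apply: fS.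
  have /existsP[l nl] : [exists l, f l \notin S].
    rewrite -negb_forall; apply: contra nS => /forallP h.
    by apply/ffun_onP => l; apply: h.
  by rewrite (bigD1 (f l)) //= (negbTE nl) codom_f oppr0 mul0r.
rewrite inj; case: forallP => [h|/forallP].
  by apply: big1 => i _; rewrite h oppr0 addr0.
rewrite negb_forall => /existsP[i ni].
by rewrite (bigD1 i) //= ni subrr mul0r.
Qed.

(** The form q of degree k vanishes where p does not, so p q is zero as a function, hence as a
    polynomial, and q = 0. By [permanent_ryser] the symmetrized value is a signed sum of values of q
    at the partial sums of the [c i]. *)
Lemma polarization k N m (tau : 'I_N -> F) (G : 'I_N -> 'I_k -> 'I_m -> F)
    (p : {mpoly F[m]}) : p != 0 ->
  (forall c, p.@[c] <> 0 ->
     \sum_j tau j * \prod_l \sum_a c a * G j l a = 0) ->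
  forall c : 'I_k -> 'I_m -> F,
    \sum_j tau j * \sum_(s : 'S_k) \prod_i \sum_a c i a * G j (s i) a = 0.
Proof.
move=> p0 hp c.
pose q : {mpoly F[m]} := \sum_j tau j *: \prod_l \sum_a G j l a *: 'X_a.
have qE v : q.@[v] = \sum_j tau j * \prod_l \sum_a v a * G j l a.
  rewrite raddf_sum /=; apply: eq_bigr => j _; rewrite mevalZ rmorph_prod /=.
  congr (_ * _); apply: eq_bigr => l _; rewrite raddf_sum /=.
  by apply: eq_bigr => a _; rewrite mevalZ mevalXU mulrC.
have q0 : q = 0.
  have /eqP : p * q = 0.
    apply: mpoly_fun_eq0 => v; rewrite mevalM.
    have [->|/eqP pv] := eqVneq (p.@[v]) 0; first by rewrite mul0r.
    by rewrite qE hp ?mulr0.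
  by rewrite mulf_eq0 (negbTE p0) => /eqP.
under eq_bigr => j _.
  have -> : \sum_(s : 'S_k) \prod_i \sum_a c i a * G j (s i) a =
      \sum_(s : 'S_k) \prod_i
        (\matrix_(i, l) \sum_a c i a * G j l a : 'M_k) i (s i).
    by apply: eq_bigr => s _; apply: eq_bigr => i _; rewrite mxE.
  rewrite permanent_ryser mulr_sumr.
  over.
rewrite exchange_big big1 //= => S _.
under eq_bigr => j _ do rewrite mulrCA.
rewrite -mulr_sumr.
suff -> : \sum_j tau j * \prod_l \sum_(i in S)
    (\matrix_(i0, l0) \sum_a c i0 a * G j l0 a : 'M_k) i l = 0 by rewrite mulr0.
transitivity q.@[fun a => \sum_(i in S) c i a]; last by rewrite q0 meval0.
rewrite qE; apply: eq_bigr => j _; congr (_ * _); apply: eq_bigr => l _.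
under eq_bigr => i _ do rewrite mxE.
by rewrite exchange_big; apply: eq_bigr => a _; rewrite mulr_suml.
Qed.

End Polarization.

(** * Fundamental forms on the diagonal *)

Section Vanishing.

Variables (F : closedFieldType) (r : nat).
Hypothesis char0 : forall n, n.+1%:R != 0 :> F.

Notation pt := 'rV[F]_r.+1.

Lemma subspace_dim_rank m (M : 'M[F]_(m, r.+1)) (A : pt -> Prop) d :
  (forall v, A v <-> (v <= M)%MS) -> subspace_dim A d -> d = \rank M.
Proof.
move=> hM [M' [/eqP rM' hM']]; rewrite -[LHS]rM'.
apply/eqP; rewrite eqn_leq; apply/andP; split; apply: mxrankS.
  by apply/rV_subP => v /hM'/hM.
by apply/rV_subP => v /hM/hM'.
Qed.

Variables (X : pt -> Prop) (k m theta : nat).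
Hypotheses (irr : irreducible X) (X0 : forall x, X x -> x != 0).

Variables (U : pt -> Prop) (B : pt -> 'M[F]_(m, r.+1)).
Variable (S : pt -> 'M[F]_(r.+1, m)).
Hypotheses (oU : open_in X U).
Hypotheses (BO : forall i j, secO 0 U (fun x => B x i j)).
Hypotheses (SO : forall i j, secO 0 U (fun x => S x i j)).
Hypotheses (BS : forall x, U x -> B x *m S x = 1%:M).
Hypotheses (hatTE : forall x, U x -> forall v, hatT X k x v <-> (v <= B x)%MS).

Lemma frame_free x : U x -> row_free (B x).
Proof. by move=> Ux; apply/row_freeP; exists (S x); apply: BS. Qed.

Lemma frame_coord x (v : pt) : U x -> (v <= B x)%MS -> v *m S x *m B x = v.
Proof. by move=> Ux /submxP[w ->]; rewrite -(mulmxA w) BS // mulmx1. Qed.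

Implicit Types (x y : pt) (D : (pt -> F) -> pt -> F).
Implicit Types (s t : pt -> 'cV[F]_r.+1).

Let derB D x : 'M[F]_(m, r.+1) := \matrix_(i, j) D (fun y => B y i j) x.

(** A section b of P_k^* (x) L^* is f B with regular coordinates f = b S, so D b = (D f) B + f (D
    B), and D acts on B at [x] through [u]. *)
Lemma fmap_sub x u v w : U x -> fmap X k x u v w ->
  (w <= col_mx (B x) (\matrix_(i, j) u (fun y => B y i j)))%MS.
Proof.
move=> Ux [U1 [D [b [[oU1 U1x] [hD hu] [bO bP] _ hw]]]].
pose U2 y := U1 y /\ U y.
have oU2 : open_in X U2 by apply: openI.
have U2x : U2 x by [].
have hD2 : vector_field X U2 D by apply: vector_field_sub hD => y [].
have BO2 i j : secO 0 U2 (fun y => B y i j) by apply: secO_sub (BO i j) => y [].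
have bB y : U2 y -> b y *m S y *m B y = b y.
  move=> [U1y Uy]; apply: frame_coord => //; apply/hatTE => // U3 s [oU3 U3y] hs.
  pose U4 z := U3 z /\ U1 z.
  apply: (bP U4 s) => //; first exact: openI.
    by move=> z [].
  by apply: ker_taylor_sub hs => z [].
have hO j : secO 0 U2 (fun y => (b y *m S y) 0 j).
  apply: (secO_ext (f := fun y => \sum_i b y 0 i * S y i j)).
    by move=> y _; rewrite mxE.
  apply: secO_sum => [y [_ /(open_sub oU)/X0]//|i]; apply: secOM0.
    by apply: secO_sub (bO i) => y [].
  by apply: secO_sub (SO i j) => y [].
have Db i : D (fun y => b y 0 i) x = \sum_j ((b x *m S x) 0 j *
    u (fun y => B y j i) + B x j i * D (fun y => (b y *m S y) 0 j) x).
  rewrite -[LHS](vf_ext oU2 hD2 (f := fun y => \sum_j (b y *m S y) 0 j * B y j i)) //.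
  - rewrite (vf_sum oU2 hD2) //; last by move=> j; apply: secOM0.
    apply: eq_bigr => j _; rewrite (vfM oU2 hD2) //; congr (_ * _ + _).
    exact: hu (BO j i).
  - by apply: secO_sum => [y [_ /(open_sub oU)/X0]//|j]; apply: secOM0.
  by move=> y U2y; rewrite -[in RHS](bB y U2y) [RHS]mxE.
rewrite -[w](subrK (\row_i D (fun y => b y 0 i) x)) addmx_sub //.
  move/hatTE: hw => /(_ Ux) hw; apply: submx_trans hw _.
  by rewrite -addsmxE addsmxSl.
pose c := \row_j D (fun y => (b y *m S y) 0 j) x.
suff -> : \row_i D (fun y => b y 0 i) x = row_mx c (b x *m S x) *m
    col_mx (B x) (\matrix_(i, j) u (fun y => B y i j)) by apply: submxMl.
apply/rowP => i; rewrite mul_row_col !mxE Db big_split addrC; congr (_ + _).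
  by apply: eq_bigr => j _; rewrite [X in _ = _ * X]mxE.
by apply: eq_bigr => j _; rewrite [c 0 j]mxE mulrC.
Qed.

Lemma fmap_rank_vector_field x u : U x -> fmap_rank X k x u theta ->
  exists U' D, [/\ open_nbhd X x U', vector_field X U' D, has_value X x D u
    & (m + theta <= \rank (col_mx (B x) (derB D x)))%N].
Proof.
move=> Ux [d hd [M [Mfree hM]]].
have dm : d = m.
  rewrite (subspace_dim_rank (hatTE Ux) hd); exact/eqP/frame_free.
(* Each value of the map comes with its own vector field. The one for w = 0 will do, since D B at
   [x] depends only on [u]. *)
have [v hv [U' [D [b [oU' [hD hu] _ _ _]]]]] := (hM 0).2 (sub0mx _ _).
exists U', D; split=> //.
have -> : derB D x = \matrix_(i, j) u (fun y => B y i j).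
  by apply/matrixP => i j; rewrite !mxE; apply: hu (BO i j).
rewrite -[X in (X + _)%N]dm -[leqLHS](eqP Mfree); apply: mxrankS; apply/rV_subP => w /hM[v' _].
exact: fmap_sub.
Qed.

(** The Taylor section of an element of ker alpha_k lies in the power k+1 of the ideal of the
    diagonal, so along the flow its derivatives of order at most k vanish. *)
Lemma hatT_flow U' D i0 y n : open_in X U' -> vector_field X U' D ->
  (forall z, U' z -> z 0 i0 != 0) -> U' y -> (n <= k)%N ->
  hatT X k y (\row_i iter n D (fun z => z 0 i / z 0 i0) y).
Proof.
move=> oU' hD hi0 U'y nk V s [oV Vy] [hs /(_ y Vy)[W [oW Wy [N [g [t E]]]]]].
have := iter_vf_taylor X0 oU' hD char0 hi0 U'y oW Wy E (leqW nk).
rewrite ltn_eqF // => <-; rewrite mxE; apply: eq_bigr => i _.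
by rewrite mxE.
Qed.

(** Differentiate B s = 0: since D s lies in ker alpha_k, also B (D s) = 0, and (D B) s = 0
    remains. *)
Lemma ker_taylor_frame x U' D s : open_in X U' -> vector_field X U' D ->
  (forall y, U' y -> U y) -> U' x -> ker_taylor X k.+1 0 U' s ->
  col_mx (B x) (derB D x) *m s x = 0.
Proof.
move=> oU' hD U'U U'x hs.
have kill y t : U' y -> ker_taylor X k 0 U' t -> B y *m t y = 0.
  move=> U'y ht; apply/row_matrixP => j; rewrite row_mul row0.
  apply/rowP => l; rewrite ord1 [RHS]mxE.
  have hj : hatT X k y (row j (B y)) by apply/hatTE; [apply: U'U|apply: row_sub].
  exact: hatT_sub hj oU' U'y ht.
have BO' i j : secO 0 U' (fun y => B y i j) by apply: secO_sub (BO i j).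
rewrite mul_col_mx kill //; last exact: ker_taylor_pred.
suff -> : derB D x *m s x = 0 by rewrite col_mx0.
apply/colP => j; rewrite [RHS]mxE.
have := kill x _ U'x (ker_taylor_derive X0 oU' hD hs).
move/colP/(_ j); rewrite [RHS]mxE mxE => h1.
have h2 : D (fun y => \sum_i B y j i * s y i 0) x = 0.
  rewrite -[RHS](vf0 oU' hD U'x); apply: (vf_ext oU' hD) => //.
    apply: secO_sum => [y /(open_sub oU')/X0//|i]; apply: secOM0 => //.
    exact: hs.1.
  move=> y U'y; have /colP/(_ j) := kill y _ U'y (ker_taylor_pred hs).
  by rewrite [in RHS]mxE mxE.
move: h2; rewrite (vf_sum oU' hD) //; last first.
  by move=> i; apply: secOM0 => //; apply: hs.1.
under eq_bigr => i _ do rewrite (vfM oU' hD (BO' j i) (hs.1 i) U'x).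
rewrite big_split /=.
under [X in X + _]eq_bigr => i _.
  rewrite (_ : D (fun y => s y i 0) x = (\col_i D (fun y => s y i 0) x) i 0).
  over.
  by rewrite mxE.
rewrite h1 add0r mxE => h2; rewrite -[RHS]h2.
by apply: eq_bigr => i _; rewrite mxE mulrC.
Qed.

Variables (x : pt) (V : pt -> Prop).
Hypotheses (Ux : U x) (oV : open_in X V) (neV : exists y, V y).
Hypothesis rank_le : forall y, U y -> V y ->
  (\rank (col_mx (B x) (B y)) <= m + theta)%N.

Lemma fund_form_diag u U' s W N (g : 'I_N -> 'I_k.+2 -> pt -> pt -> F)
    (tau : 'I_N -> pt -> pt -> F) :
  (0 < k)%N -> fmap_rank X k x u theta -> open_nbhd X x U' ->
  secR X k.+1 U' s -> open_in2 X W -> W x x ->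
  Ipow_expr (-1) 1 W g tau (taylor s) ->
  \sum_j tau j x x * \prod_l u (g j l x) = 0.
Proof.
move=> k0 /(fmap_rank_vector_field Ux)[U1 [D [[oU1 U1x] hD1 hu rank_ge]]].
move=> [oU' U'x] hs oW Wx E.
have /rV0Pn[i0 xi0] := X0 (open_sub oU Ux).
pose U2 y := (U y /\ U' y) /\ (U1 y /\ (X y /\ evp 'X_i0 y <> 0)).
have oU2 : open_in X U2.
  apply: openI; first exact: openI.
  by apply: openI => //; apply: (open_ne X0 (dhomog_coord F i0)).
have U2x : U2 x.
  split=> //; split=> //; split; first exact: open_sub oU Ux.
  by rewrite evpX; apply/eqP.
have U2i0 y : U2 y -> y 0 i0 != 0 by move=> [_ [_ [_]]]; rewrite evpX => /eqP.
have U2U y : U2 y -> U y by case=> [[]].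
have hD : vector_field X U2 D by apply: vector_field_sub hD1 => y [_ []].
have BO2 i j : secO 0 U2 (fun y => B y i j) by apply: secO_sub (BO i j).
(* With k positive, b and b' have orders k-1 and k and so stay in the osculating space, while b'''
   has order exactly k+2. *)
pose b i := iter k.-1 D (fun z : pt => z 0 i / z 0 i0).
have bO i : secO 0 U2 (b i).
  by apply: (iter_vf_secO oU2 hD); apply: secO_ratio.
have sub0 y : U2 y -> (\row_i iter 0 D (b i) y <= B y)%MS.
  move=> U2y; apply/hatTE; first exact: U2U.
  exact: (hatT_flow oU2 hD U2i0 U2y (leq_pred k)).
have sub1 y : U2 y -> (\row_i iter 1 D (b i) y <= B y)%MS.
  move=> U2y; apply/hatTE; first exact: U2U.
  have := hatT_flow oU2 hD U2i0 U2y (leqnn k).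
  by rewrite -[in iter k](prednK k0).
have := trapezoid_rule char0 irr X0 oU2 hD oV neV U2x BO2 bO
  (frame_free Ux) (fun y U2y Vy => rank_le (U2U y U2y) Vy) rank_ge sub0 sub1.
move=> /submxP[c hc].
(* Multiplication by the coordinate x_i0 undoes the twist by O(-1) in R_{k+1}. *)
have hs0 : ker_taylor X k.+1 0 U2 (fun y => y 0 i0 *: s y).
  apply: (@ker_taylorZ _ _ _ _ (-1) 1) => //; first exact: secO_coord.
  by apply: ker_taylor_sub hs => y [[]].
have kill := ker_taylor_frame oU2 hD U2U U2x hs0.
have := iter_vf_taylor X0 oU2 hD char0 U2i0 U2x oW Wx E (leqnn _).
rewrite eqxx.
have -> : \sum_i iter k.+2 D (fun y => y 0 i / y 0 i0) x * s x i 0 = 0.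
  transitivity ((\row_i iter 3 D (b i) x *m s x) 0 0).
    rewrite mxE; apply: eq_bigr => i _; rewrite mxE /b -iterD.
    by rewrite (_ : 3 + k.-1 = k.+2)%N //; lia.
  rewrite hc -mulmxA -[s x](scalerK xi0) -scalemxAr kill.
  by rewrite scaler0 mulmx0 mxE.
move=> /esym/eqP; rewrite mulf_eq0 (negbTE (fact_neq0 char0 _)) /=.
have uE j l : D (g j l x) x = u (g j l x).
  case: E => hg _ _; apply: (hu (W x)); last exact: secO_snd (hg j l).1.
  split=> //; apply: open_snd => //; exact: open_sub oU Ux.
under eq_bigr => j _.
  under eq_bigr => l _ do rewrite uE.
  rewrite mulrA; over.
rewrite -mulr_suml mulf_eq0 invr_eq0 (negbTE xi0) orbF => /eqP h.
by rewrite -[RHS]h; apply: eq_bigr => j _; rewrite mulrC.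
Qed.

End Vanishing.

(** * The theorem at a generic point *)

Lemma quasi_projective_neq0 (F : closedFieldType) r (X : 'rV[F]_r.+1 -> Prop) :
  quasi_projective_variety X -> forall x, X x -> x != 0.
Proof. by move=> [_ [Z1 [Z2 [[S [_ hZ]] _ hX]]]] x /hX[/hZ[]]. Qed.

Lemma generic_fund_form_zero (F : closedFieldType) (r k theta : nat)
    (X : 'rV[F]_r.+1 -> Prop) (t delta : int) :
  (forall n, n.+1%:R != 0 :> F) -> quasi_projective_variety X -> (0 < k)%N ->
  is_t X k t -> is_theta X k theta -> is_delta X k delta ->
  t = theta%:Z + delta -> generically X (fund_form_zero X k.+2).
Proof.
move=> char0 qX k0 [m rkP tE] [Ut [oUt neUt hUt]] [W [oW [x1 [y1 Wxy]] hW]] tdE.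
have X0 := quasi_projective_neq0 qX; have irr := qX.1.
have [U [B [S [oU neU [BO SO] BS hatTE]]]] := generic_frame irr X0 rkP.
have [Xx1 Xy1] := open2_sub oW Wxy.
(* The fixed point [y1] witnesses that, for each such [x], the open set of partners [y] in general
   position to [x] is nonempty. *)
have oV : open_in X (fun x => Ut x /\ W x y1).
  by apply: openI => //; apply: open_fst.
exists (fun x => U x /\ (Ut x /\ W x y1)); split; first exact: openI.
  apply: (open_meet irr) => //.
  by apply: (open_meet irr) => //; [apply: open_fst|exists x1].
move=> x [Ux [/hUt[_ [n [e [p [[te span _] p0 hp]]]]] Wx]].
have oWx : open_in X (W x) by apply: open_snd => //; apply: open_sub Ux.
(* Grassmann's formula 2m - d with d = delta + 1; t + 1 = m and t = theta + delta give m = theta +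
   d. *)
have rank_le y : U y -> W x y -> (\rank (col_mx (B x) (B y)) <= m + theta)%N.
  move=> Uy /hW[d hd dE].
  have {}hd : d = \rank (B x :&: B y)%MS.
    apply: subspace_dim_rank hd => v; rewrite sub_capmx.
    by split=> [[/hatTE-> // /hatTE-> //]|/andP[h1 h2]]; split; apply/hatTE.
  have := mxrank_sum_cap (B x) (B y); rewrite addsmxE -hd.
  have /eqP -> := frame_free BS Ux; have /eqP -> := frame_free BS Uy.
  have mE : (theta + d = m)%N by lia.
  by rewrite -(leq_add2r d) => ->; rewrite -addnA mE.
move=> u s c hu [[U' oU' hs] [W' [N [g [tau [oW' W'x E ->]]]]]].
(* Arbitrary tangent vectors are expanded on the basis in which genericity of u is a polynomial
   condition p(c) <> 0, the input for [polarization]. *)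
have /fin_all_exists[a ha] i := span (u i) (hu i).
pose G j l b := e b (g j l x).
have := @polarization F k.+2 N n (fun j => tau j x x) G p p0 _ a.
rewrite /sym_pairing => H; rewrite -[RHS]H => [|v /hp hv].
  apply: eq_bigr => j _; congr (_ * _); apply: eq_bigr => sg _.
  apply: eq_bigr => i _; apply: (ha i (W' x)).
    by split=> //; apply: open_snd => //; apply: open_sub Ux.
  by case: E => hg _ _; apply: secO_snd (hg j (sg i)).1.
exact: (fund_form_diag char0 irr X0 oU BO SO BS hatTE Ux oWx
  (ex_intro _ y1 Wx) rank_le k0 hv oU' hs oW' W'x E).
Qed.

Theorem theorem1p1 (R : realType) (r n k : nat)
    (X : 'rV[R[i]]_r.+1 -> Prop) (t_k delta_k : int) (theta_k : nat)
    (hX : quasi_projective_variety X) (hdim : has_dim X n)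
    (hn : (1 <= n)%N) (hk : (1 <= k)%N)
    (ht : is_t X k t_k) (htheta : is_theta X k theta_k)
    (hdelta : is_delta X k delta_k)
    (heq : t_k = theta_k%:Z + delta_k) :
  generically X (fund_form_zero X k.+2).
Proof.
apply: generic_fund_form_zero hX hk ht htheta hdelta heq => m.
by rewrite Num.Theory.pnatr_eq0.
Qed.
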